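(* Fix an integer $d\ge 2$. For integers $n\ge d$ and $m\ge 2$, let $n$ balls be placed independently into $m$ urns, each ball falling into each urn with probability $1/m$, and let $Y_n$ be the number of urns containing exactly $d$ balls. Let $\mu_{n,m}=E Y_n$ and $\sigma_{n,m}^2=\mathrm{Var}(Y_n)$ (explicitly given in the context), let $$r_{n,m}=\frac{\sigma_{n,m}}{1+(n/m)^3},\qquad W_{n,m}=\frac{Y_n-\mu_{n,m}}{\sigma_{n,m}}.$$ Then there exists a constant $C$ depending only on $d$ such that $$\sup_{z\in\mathbb{R}}\left|P(W_{n,m}\le z)-P(Z\le z)\right|\le \frac{C}{r_{n,m}}\quad\text{for all } n\ge d \text{ and } m\ge 2,$$ where $Z$ is a standard normal random variable.
   Context: Uniform multinomial occupancy model: $n$ balls are distributed independently and uniformly over $m$ urns. For $d\ge 0$, $Y_n$ is the number of urns containing exactly $d$ balls. Its mean and variance are $$\mu_{n,m}=m\binom{n}{d}\frac{1}{m^d}\Big(1-\frac1m\Big)^{n-d},$$ $$\sigma_{n,m}^2=\mu_{n,m}+m(m-1)\binom{n}{d,\,d,\,n-2d}\frac{1}{m^{2d}}\Big(1-\frac2m\Big)^{n-2d}-\mu_{n,m}^2,$$ where the middle term is taken to be $0$ when $d\le n<2d$, and $\binom{n}{d,d,n-2d}=\frac{n!}{d!\,d!\,(n-2d)!}$ is the multinomial coefficient. ($\sigma_{n,m}^2>0$ for all $n\ge d$, $m\ge 2$.) *)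

(* Defs.v *)
From Stdlib Require Import Reals Lra Arith List.
Open Scope R_scope.

(* Outcomes: n balls into m urns, an outcome is the list of urn labels
   (each in {0,..,m-1}) of the n balls; all m^n outcomes equally likely. *)
Fixpoint assignments (n m : nat) : list (list nat) :=
  match n with
  | O => nil :: nil
  | S k => flat_map (fun l => map (fun j => j :: l) (seq 0 m)) (assignments k m)
  end.

Definition occY (d m : nat) (l : list nat) : nat :=
  length (filter (fun j => Nat.eqb (count_occ Nat.eq_dec l j) d) (seq 0 m)).

Definition mu_nm (d n m : nat) : R :=
  INR m * C n d * (1 / INR m) ^ d * (1 - 1 / INR m) ^ (n - d).

Definition sigma2_nm (d n m : nat) : R :=
  mu_nm d n m
  + (if Nat.ltb n (2 * d) then 0
     else INR m * (INR m - 1)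
          * (INR (fact n) / (INR (fact d) * INR (fact d) * INR (fact (n - 2 * d))))
          * (1 / INR m) ^ (2 * d) * (1 - 2 / INR m) ^ (n - 2 * d))
  - mu_nm d n m ^ 2.

Definition sigma_nm (d n m : nat) : R := sqrt (sigma2_nm d n m).

Definition r_nm (d n m : nat) : R :=
  sigma_nm d n m / (1 + (INR n / INR m) ^ 3).

Definition W_nm (d n m : nat) (l : list nat) : R :=
  (INR (occY d m l) - mu_nm d n m) / sigma_nm d n m.

Definition probW_le (d n m : nat) (z : R) : R :=
  INR (length (filter (fun l => if Rle_dec (W_nm d n m l) z then true else false)
                      (assignments n m)))
  / INR m ^ n.

Definition std_normal_density (t : R) : R := exp (- t ^ 2 / 2) / sqrt (2 * PI).

(* Phi is the standard normal CDF: its derivative is the density and it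
   tends to 0 at -infinity (this determines Phi uniquely). *)
Definition is_std_normal_cdf (Phi : R -> R) : Prop :=
  (forall z, derivable_pt_lim Phi z (std_normal_density z)) /\
  (forall eps, eps > 0 -> exists M, forall x, x < M -> Rabs (Phi x) < eps).

(* Main.v *)
Require Import Defs.
From Stdlib Require Import Reals Lra Lia Psatz Arith List.
From Coquelicot Require Import Rcomplements Hierarchy Continuity Derive RInt RInt_analysis AutoDerive.
Open Scope R_scope.

(* Stein's method for the chain that picks a ball and throws it again.  Let L be the generator in which every
   ball is thrown again at rate 1.  The number of balls in one urn is a birth and death chain, so the Poisson
   equation [- L H = Y - mu] has an explicit solution H = sum_j phi(N_j) whose increments [phi (k + 1) - phi k]
   are at most 2 / (k + 1) in absolute value, by log-concavity of the binomial weights.  With l' the outcome l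
   after one move, reversibility gives E[(Y - mu) f] = 1/2 E sum (H l - H l') (f l - f l').  For the Stein
   solution f, f' is a sum of monotone functions, so the error of the first-order expansion of f telescopes by
   antisymmetry, as in the work of Shao and Zhang on unbounded exchangeable pairs; no bound on the jumps of Y
   is lost and
     |P(W <= z) - Phi z| <= (sd T + 8 sd U) / sigma^2,
   where T = sum (H l - H l') (Y l - Y l') and U = sum (Y l - Y l').  Both T and U are, up to products of two
   linear statistics, of the form sum_j v(N_j) with v supported on {d - 1, d, d + 1}; the Efron-Stein inequality
   bounds their variances by a multiple of mu (1 + n/m)^4.  Finally sigma^2 >= mu / 6, by conditioning on
   the number of balls in each pair of urns. *)

(** * Uniform outcomes, re-throwing a ball, and the Efron-Stein inequality *)

(** [Y] alone satisfies no linear regression under the chain: the drift of the number of urns with d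
    balls involves urns with d + 1 and d - 1 balls. Replacing one difference of [Y] by a difference
    of [H] makes the regression exact, so only two variances remain to be estimated. Everything is
    measured against mu = m * [pb m n d], uniformly in n/m. A linear statistic supported near d has
    a variance of that order, except that the weight at d - 1 can exceed the weight at d by a factor
    of order m/n; values at d - 1 must therefore be of order n/m. One product in T violates this and
    is rewritten by the Poisson equation. Both standard deviations are at most of order sigma * (1 +
    n/m)^2, so the bound is of order (1 + n/m)^2 / sigma, and (1 + x)^2 <= 4 * (1 + x^3) for x >= 0
    gives the stated form. The hypothesis on [Phi] fixes only its derivative and its limit at minus
    infinity. Total mass one, hence Phi (- z) = 1 - Phi z, has to be derived, which is why the
    Gaussian integral is computed. *)

Definition lsum {A : Type} (f : A -> R) (l : list A) : R :=
  fold_right (fun x s => f x + s) 0 l.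

Lemma lsum_cons {A} (f : A -> R) a l : lsum f (a :: l) = f a + lsum f l.
Proof. reflexivity. Qed.

Lemma lsum_ext {A} (f g : A -> R) l :
  (forall x, In x l -> f x = g x) -> lsum f l = lsum g l.
Proof.
induction l as [|a l IH]; intros H; simpl; [reflexivity|].
rewrite (H a) by (left; reflexivity). f_equal. apply IH. intros x Hx; apply H; right; exact Hx.
Qed.

Lemma lsum_plus {A} (f g : A -> R) l :
  lsum (fun x => f x + g x) l = lsum f l + lsum g l.
Proof. induction l as [|a l IH]; simpl; [|rewrite IH]; ring. Qed.

Lemma lsum_scal {A} c (f : A -> R) l : lsum (fun x => c * f x) l = c * lsum f l.
Proof. induction l as [|a l IH]; simpl; [|rewrite IH]; ring. Qed.

Lemma lsum_minus {A} (f g : A -> R) l :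
  lsum (fun x => f x - g x) l = lsum f l - lsum g l.
Proof. induction l as [|a l IH]; simpl; [|rewrite IH]; ring. Qed.

Lemma lsum_const {A} c (l : list A) : lsum (fun _ => c) l = INR (length l) * c.
Proof.
induction l as [|a l IH]; [simpl; ring|].
change (length (a :: l)) with (S (length l)). rewrite S_INR; simpl. rewrite IH; ring.
Qed.

Lemma lsum_le {A} (f g : A -> R) l :
  (forall x, In x l -> f x <= g x) -> lsum f l <= lsum g l.
Proof.
induction l as [|a l IH]; intros H; simpl; [lra|].
apply Rplus_le_compat; [apply H; left; reflexivity|apply IH; intros x Hx; apply H; right; exact Hx].
Qed.

Lemma lsum_nonneg {A} (f : A -> R) l : (forall x, In x l -> 0 <= f x) -> 0 <= lsum f l.
Proof.
intros H. replace 0 with (lsum (fun _ : A => 0) l) by (rewrite lsum_const; ring).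
apply lsum_le; exact H.
Qed.

Lemma lsum_Rabs {A} (f : A -> R) l : Rabs (lsum f l) <= lsum (fun x => Rabs (f x)) l.
Proof.
induction l as [|a l IH]; simpl; [rewrite Rabs_R0; lra|].
eapply Rle_trans; [apply Rabs_triang|lra].
Qed.

Lemma lsum_app {A} (f : A -> R) l1 l2 : lsum f (l1 ++ l2) = lsum f l1 + lsum f l2.
Proof. induction l1 as [|a l IH]; simpl; [|rewrite IH]; ring. Qed.

Lemma lsum_map {A B} (f : B -> R) (h : A -> B) l :
  lsum f (map h l) = lsum (fun x => f (h x)) l.
Proof. induction l as [|a l IH]; simpl; [|rewrite IH]; ring. Qed.

Lemma lsum_flat_map {A B} (f : B -> R) (h : A -> list B) l :
  lsum f (flat_map h l) = lsum (fun x => lsum f (h x)) l.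
Proof. induction l as [|a l IH]; simpl; [|rewrite lsum_app, IH]; ring. Qed.

Lemma lsum_exchange {A B} (f : A -> B -> R) la lb :
  lsum (fun a => lsum (f a) lb) la = lsum (fun b => lsum (fun a => f a b) la) lb.
Proof.
induction la as [|a l IH]; simpl.
- rewrite lsum_const; ring.
- rewrite lsum_plus, IH; reflexivity.
Qed.

Lemma lsum_filter_length {A} (p : A -> bool) l :
  INR (length (filter p l)) = lsum (fun x => if p x then 1 else 0) l.
Proof.
induction l as [|a l IH]; [reflexivity|]. simpl. destruct (p a).
- change (length (a :: filter p l)) with (S (length (filter p l))). rewrite S_INR, IH; ring.
- rewrite IH; ring.
Qed.

Lemma lsum_seq_single (f : nat -> R) m j :
  (j < m)%nat -> lsum (fun k => if Nat.eqb k j then f k else 0) (seq 0 m) = f j.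
Proof.
induction m as [|m IH]; intros H; [lia|].
rewrite seq_S, lsum_app. simpl.
destruct (Nat.eq_dec j m) as [->|Hne].
- rewrite Nat.eqb_refl.
  rewrite (lsum_ext _ (fun _ => 0)), lsum_const; [ring|].
  intros x Hx; apply in_seq in Hx. destruct (Nat.eqb_spec x m); [lia|reflexivity].
- rewrite IH by lia. destruct (Nat.eqb_spec m j); [lia|ring].
Qed.

Lemma lsum_seq_shift (f : nat -> R) s c :
  lsum (fun t => f (s + t)%nat) (seq 0 c) = lsum f (seq s c).
Proof.
induction c as [|c IH]; [reflexivity|].
rewrite !seq_S, !lsum_app, IH. reflexivity.
Qed.

Definition avg (m : nat) (f : nat -> R) : R := lsum f (seq 0 m) / INR m.

Section Uniform.

Variable m : nat.
Hypothesis hm : (2 <= m)%nat.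

Lemma mpos : 2 <= INR m.
Proof. apply (le_INR 2); exact hm. Qed.

Lemma avg_ext f g : (forall j, (j < m)%nat -> f j = g j) -> avg m f = avg m g.
Proof. intros H; unfold avg; f_equal; apply lsum_ext; intros x Hx; apply in_seq in Hx; apply H; lia. Qed.

Lemma avg_plus f g : avg m (fun j => f j + g j) = avg m f + avg m g.
Proof. unfold avg; rewrite lsum_plus; unfold Rdiv; ring. Qed.

Lemma avg_minus f g : avg m (fun j => f j - g j) = avg m f - avg m g.
Proof. unfold avg; rewrite lsum_minus; unfold Rdiv; ring. Qed.

Lemma avg_scal c f : avg m (fun j => c * f j) = c * avg m f.
Proof. unfold avg; rewrite lsum_scal; unfold Rdiv; ring. Qed.

Lemma avg_const c : avg m (fun _ => c) = c.
Proof. unfold avg; rewrite lsum_const, length_seq. pose proof mpos; field; lra. Qed.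

Lemma avg_le f g : (forall j, (j < m)%nat -> f j <= g j) -> avg m f <= avg m g.
Proof.
intros H; unfold avg, Rdiv. pose proof mpos.
apply Rmult_le_compat_r; [left; apply Rinv_0_lt_compat; lra|].
apply lsum_le; intros x Hx; apply in_seq in Hx; apply H; lia.
Qed.

Lemma avg_exchange (f : nat -> nat -> R) :
  avg m (fun a => avg m (f a)) = avg m (fun b => avg m (fun a => f a b)).
Proof.
unfold avg, Rdiv. f_equal.
rewrite (lsum_ext _ (fun a => / INR m * lsum (f a) (seq 0 m))) by (intros; ring).
rewrite (lsum_ext (fun b => lsum (fun a => f a b) (seq 0 m) * / INR m)
  (fun b => / INR m * lsum (fun a => f a b) (seq 0 m))) by (intros; ring).
rewrite !lsum_scal. f_equal. apply lsum_exchange.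
Qed.

Lemma avg_sq_le f : avg m f ^ 2 <= avg m (fun j => f j ^ 2).
Proof.
assert (H : 0 <= avg m (fun j => (f j - avg m f) ^ 2)).
{ rewrite <- (avg_const 0). apply avg_le. intros j _. apply pow2_ge_0. }
rewrite (avg_ext _ (fun j => (f j ^ 2 - 2 * avg m f * f j) + avg m f ^ 2)) in H by (intros; ring).
rewrite avg_plus, avg_minus, avg_scal, avg_const in H. nra.
Qed.

Definition Ex (n : nat) (f : list nat -> R) : R := lsum f (assignments n m) / INR m ^ n.

Lemma Ex_0 f : Ex 0 f = f nil.
Proof. unfold Ex; simpl; field. Qed.

Lemma Ex_S n f : Ex (S n) f = Ex n (fun l => avg m (fun j => f (j :: l))).
Proof.
unfold Ex, avg. simpl assignments. rewrite lsum_flat_map.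
rewrite (lsum_ext (fun x => lsum f (map (fun j => j :: x) (seq 0 m)))
  (fun l => lsum (fun j => f (j :: l)) (seq 0 m))) by (intros; apply lsum_map).
unfold Rdiv.
rewrite (lsum_ext (fun l => lsum (fun j => f (j :: l)) (seq 0 m) * / INR m)
  (fun l => / INR m * lsum (fun j => f (j :: l)) (seq 0 m))) by (intros; ring).
rewrite lsum_scal. pose proof mpos. simpl. field.
split; [apply pow_nonzero; lra|lra].
Qed.

Definition outcome (n : nat) (l : list nat) : Prop :=
  length l = n /\ forall j, In j l -> (j < m)%nat.

Lemma assignments_outcome n l : In l (assignments n m) -> outcome n l.
Proof.
revert l; induction n as [|n IH]; simpl; intros l H.
- destruct H as [<-|[]]; split; [reflexivity|intros j []].
- apply in_flat_map in H; destruct H as [l' [Hl' H]].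
  apply in_map_iff in H; destruct H as [j [<- Hj]]. apply in_seq in Hj.
  destruct (IH l' Hl') as [H1 H2]. split; [simpl; lia|].
  intros k [<-|Hk]; [lia|apply H2; exact Hk].
Qed.

Lemma Ex_ext n f g : (forall l, outcome n l -> f l = g l) -> Ex n f = Ex n g.
Proof.
intros H; unfold Ex; f_equal; apply lsum_ext.
intros l Hl; apply H; apply assignments_outcome; exact Hl.
Qed.

Lemma Ex_le n f g : (forall l, outcome n l -> f l <= g l) -> Ex n f <= Ex n g.
Proof.
intros H; unfold Ex, Rdiv. pose proof mpos.
apply Rmult_le_compat_r; [left; apply Rinv_0_lt_compat, pow_lt; lra|].
apply lsum_le; intros l Hl; apply H; apply assignments_outcome; exact Hl.
Qed.

Lemma Ex_plus n f g : Ex n (fun l => f l + g l) = Ex n f + Ex n g.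
Proof. unfold Ex; rewrite lsum_plus; unfold Rdiv; ring. Qed.

Lemma Ex_minus n f g : Ex n (fun l => f l - g l) = Ex n f - Ex n g.
Proof. unfold Ex; rewrite lsum_minus; unfold Rdiv; ring. Qed.

Lemma Ex_scal n c f : Ex n (fun l => c * f l) = c * Ex n f.
Proof. unfold Ex; rewrite lsum_scal; unfold Rdiv; ring. Qed.

Lemma Ex_const n c : Ex n (fun _ => c) = c.
Proof.
induction n as [|n IH]; [apply Ex_0|]. rewrite Ex_S.
transitivity (Ex n (fun _ => c)); [|exact IH]. apply Ex_ext; intros; apply avg_const.
Qed.

Lemma Ex_lsum {A} n (f : A -> list nat -> R) (s : list A) :
  Ex n (fun l => lsum (fun a => f a l) s) = lsum (fun a => Ex n (f a)) s.
Proof.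
induction s as [|a s IH]; simpl; [apply Ex_const|].
rewrite Ex_plus, IH; reflexivity.
Qed.

Lemma Ex_nonneg n f : (forall l, outcome n l -> 0 <= f l) -> 0 <= Ex n f.
Proof. intros H; rewrite <- (Ex_const n 0); apply Ex_le; exact H. Qed.

Lemma Ex_Rabs n f : Rabs (Ex n f) <= Ex n (fun l => Rabs (f l)).
Proof.
apply Rabs_le; split.
- replace (- Ex n (fun l => Rabs (f l))) with (Ex n (fun l => (-1) * Rabs (f l))) by (rewrite Ex_scal; ring).
  apply Ex_le; intros l _.
  unfold Rabs; destruct (Rcase_abs (f l)); lra.
- apply Ex_le; intros; apply Rle_abs.
Qed.

Lemma Ex_CS n f g : Ex n (fun l => f l * g l) ^ 2 <= Ex n (fun l => f l ^ 2) * Ex n (fun l => g l ^ 2).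
Proof.
set (a := Ex n (fun l => f l ^ 2)). set (b := Ex n (fun l => g l ^ 2)).
set (c := Ex n (fun l => f l * g l)).
assert (Q : forall s t, 0 <= s ^ 2 * a + 2 * (s * t) * c + t ^ 2 * b).
{ intros s t. unfold a, b, c. rewrite <- !Ex_scal, <- !Ex_plus.
  apply Ex_nonneg; intros l _.
  replace (_ + _) with ((s * f l + t * g l) ^ 2) by ring. apply pow2_ge_0. }
assert (Ha : 0 <= a) by (apply Ex_nonneg; intros; apply pow2_ge_0).
assert (Hb : 0 <= b) by (apply Ex_nonneg; intros; apply pow2_ge_0).
destruct (Req_dec a 0) as [Ea|Na].
- rewrite Ea in *. destruct (Req_dec c 0) as [->|Nc]; [nra|].
  (* With a = 0 the form at (s, 1) is 2 * s * c + b; this s makes it -1, a contradiction. *)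
  specialize (Q (- (b + 1) / (2 * c)) 1).
  assert (H : 2 * (- (b + 1) / (2 * c) * 1) * c = - (b + 1)) by (field; exact Nc). nra.
(* The form at (- c, a) equals a * (a * b - c ^ 2). *)
- specialize (Q (- c) a). nra.
Qed.

Definition Var (n : nat) (f : list nat -> R) : R := Ex n (fun l => (f l - Ex n f) ^ 2).

Lemma Ex_sq_shift n f c : Ex n (fun l => (f l - c) ^ 2) = Var n f + (Ex n f - c) ^ 2.
Proof.
unfold Var. set (e := Ex n f).
rewrite (Ex_ext n (fun l => (f l - c) ^ 2)
  (fun l => (f l - e) ^ 2 + ((2 * (e - c)) * f l + ((e - c) ^ 2 - 2 * (e - c) * e)))) by (intros; ring).
rewrite !Ex_plus, Ex_scal, Ex_const. fold e. ring.
Qed.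

Lemma Var_sq n f : Var n f = Ex n (fun l => f l ^ 2) - Ex n f ^ 2.
Proof.
generalize (Ex_sq_shift n f 0).
rewrite (Ex_ext n (fun l => (f l - 0) ^ 2) (fun l => f l ^ 2)) by (intros; ring). lra.
Qed.

Lemma Var_nonneg n f : 0 <= Var n f.
Proof. apply Ex_nonneg; intros; apply pow2_ge_0. Qed.

Lemma Var_ext n f g : (forall l, outcome n l -> f l = g l) -> Var n f = Var n g.
Proof.
intros H. unfold Var. rewrite (Ex_ext n f g H).
apply Ex_ext; intros l Hl; rewrite (H l Hl); reflexivity.
Qed.

Lemma Var_le_sq n f c : Var n f <= Ex n (fun l => (f l - c) ^ 2).
Proof. rewrite Ex_sq_shift. generalize (pow2_ge_0 (Ex n f - c)); lra. Qed.

Lemma Var_scal n c f : Var n (fun l => c * f l) = c ^ 2 * Var n f.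
Proof.
unfold Var. rewrite Ex_scal, <- (Ex_scal n (c ^ 2)). apply Ex_ext; intros; ring.
Qed.

Lemma Var_plus_le n f g : Var n (fun l => f l + g l) <= 2 * Var n f + 2 * Var n g.
Proof.
unfold Var. rewrite (Ex_plus n f g). set (a := Ex n f). set (b := Ex n g).
rewrite <- !(Ex_scal n 2), <- Ex_plus.
apply Ex_le; intros l _.
generalize (pow2_ge_0 ((f l - a) - (g l - b))). nra.
Qed.

Lemma Ex_Rabs_le_sd n f : Ex n (fun l => Rabs (f l - Ex n f)) <= sqrt (Var n f).
Proof.
apply Rsqr_incr_0_var; [|apply sqrt_pos].
rewrite Rsqr_sqrt by apply Var_nonneg.
generalize (Ex_CS n (fun l => Rabs (f l - Ex n f)) (fun _ => 1)).
rewrite (Ex_ext n (fun l => Rabs (f l - Ex n f) * 1) (fun l => Rabs (f l - Ex n f))) by (intros; ring).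
rewrite (Ex_ext n (fun l => Rabs (f l - Ex n f) ^ 2) (fun l => (f l - Ex n f) ^ 2)) by (intros; apply pow2_abs).
rewrite Ex_const. unfold Var, Rsqr. lra.
Qed.

(** A B - (E A) (E B) = A (B - E B) + (E B) (A - E A), and the square of a sum is at most twice the
    sum of the squares. Centering at the product of the means is harmless since the true mean
    minimizes the mean square. Only [A] has to be bounded uniformly; [B] can be a local statistic of
    small mean and variance. *)
Lemma Var_prod_le n A B alpha :
  (forall l, outcome n l -> Rabs (A l) <= alpha) ->
  Var n (fun l => A l * B l) <= 2 * alpha ^ 2 * Var n B + 2 * Ex n B ^ 2 * Var n A.
Proof.
intros H. eapply Rle_trans; [apply (Var_le_sq n _ (Ex n A * Ex n B))|].
unfold Var. set (a := Ex n A). set (b := Ex n B).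
rewrite <- !Ex_scal, <- Ex_plus. apply Ex_le; intros l Hl.
specialize (H l Hl).
assert (H2 : A l ^ 2 <= alpha ^ 2).
{ rewrite <- (pow2_abs (A l)). generalize (Rabs_pos (A l)); nra. }
assert (H3 : A l ^ 2 * (B l - b) ^ 2 <= alpha ^ 2 * (B l - b) ^ 2).
{ apply Rmult_le_compat_r; [apply pow2_ge_0|exact H2]. }
assert (E : (A l * B l - a * b) ^ 2 = (A l * (B l - b) + b * (A l - a)) ^ 2) by ring.
rewrite E. generalize (pow2_ge_0 (A l * (B l - b) - b * (A l - a))). nra.
Qed.

(* [swapsum l h - length l * h l] is the generator of the chain applied to [h]: the sum over the balls i of the
   mean of [h] after ball i of [l] is thrown again. *)
Fixpoint swapsum (l : list nat) (h : list nat -> R) : R :=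
  match l with
  | nil => 0
  | a :: l' => avg m (fun k => h (k :: l')) + swapsum l' (fun l'' => h (a :: l''))
  end.

Lemma swapsum_ext n l f g : outcome n l -> (forall l', outcome n l' -> f l' = g l') ->
  swapsum l f = swapsum l g.
Proof.
revert n f g; induction l as [|a l IH]; intros n f g [H1 H2] H; simpl in *; [reflexivity|].
f_equal.
- apply avg_ext; intros j Hj. apply H. split; [exact H1|].
  intros k [<-|Hk]; [exact Hj|apply H2; right; exact Hk].
- apply (IH (length l)); [split; [reflexivity|intros; apply H2; right; assumption]|].
  intros l' [H3 H4]; apply H; split; [simpl; lia|].
  intros k [<-|Hk]; [apply H2; left; reflexivity|apply H4; exact Hk].
Qed.

Lemma swapsum_plus l f g : swapsum l (fun l' => f l' + g l') = swapsum l f + swapsum l g.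
Proof.
revert f g; induction l as [|a l IH]; intros f g; simpl; [ring|].
rewrite avg_plus, IH; ring.
Qed.

Lemma swapsum_scal l c f : swapsum l (fun l' => c * f l') = c * swapsum l f.
Proof.
revert f; induction l as [|a l IH]; intros f; simpl; [ring|].
rewrite avg_scal, IH; ring.
Qed.

Lemma swapsum_minus l f g : swapsum l (fun l' => f l' - g l') = swapsum l f - swapsum l g.
Proof.
revert f g; induction l as [|a l IH]; intros f g; simpl; [ring|].
rewrite avg_minus, IH; ring.
Qed.

Lemma swapsum_le n l f g : outcome n l -> (forall l', outcome n l' -> f l' <= g l') ->
  swapsum l f <= swapsum l g.
Proof.
revert n f g; induction l as [|a l IH]; intros n f g [H1 H2] H; simpl in *; [lra|].
apply Rplus_le_compat.
- apply avg_le; intros j Hj. apply H. split; [exact H1|].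
  intros k [<-|Hk]; [exact Hj|apply H2; right; exact Hk].
- apply (IH (length l)); [split; [reflexivity|intros; apply H2; right; assumption]|].
  intros l' [H3 H4]; apply H; split; [simpl; lia|].
  intros k [<-|Hk]; [apply H2; left; reflexivity|apply H4; exact Hk].
Qed.

Lemma Ex_avg n (f : nat -> list nat -> R) :
  Ex n (fun l => avg m (fun j => f j l)) = avg m (fun j => Ex n (f j)).
Proof.
unfold avg. rewrite (Ex_ext n _ (fun l => / INR m * lsum (fun j => f j l) (seq 0 m))) by (intros; unfold Rdiv; ring).
rewrite Ex_scal, Ex_lsum. unfold Rdiv; ring.
Qed.

(** Reversibility with respect to the uniform law: given the other balls, the old and the new label
    of the moved ball are independent and uniform, hence exchangeable. The induction peels off the
    head ball, which is either the moved one or a fixed spectator. *)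
Lemma swapsum_exchangeable n (K : list nat -> list nat -> R) :
  Ex n (fun l => swapsum l (fun l' => K l l')) = Ex n (fun l => swapsum l (fun l' => K l' l)).
Proof.
revert K; induction n as [|n IH]; intros K; [rewrite !Ex_0; reflexivity|].
rewrite !Ex_S; simpl.
rewrite (Ex_ext n _ (fun l => avg m (fun a => avg m (fun k => K (a :: l) (k :: l)))
  + avg m (fun a => swapsum l (fun l' => K (a :: l) (a :: l'))))) by (intros; apply avg_plus).
rewrite (Ex_ext n (fun l => avg m (fun j => avg m (fun k => K (k :: l) (j :: l)) + swapsum l (fun l' => K (j :: l') (j :: l))))
  (fun l => avg m (fun a => avg m (fun k => K (k :: l) (a :: l)))
  + avg m (fun a => swapsum l (fun l' => K (a :: l') (a :: l))))) by (intros; apply avg_plus).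
rewrite !Ex_plus. f_equal.
- apply Ex_ext; intros. apply avg_exchange.
- rewrite !Ex_avg. apply avg_ext; intros a Ha. apply (IH (fun l l' => K (a :: l) (a :: l'))).
Qed.

Lemma swapsum_avg l (f : nat -> list nat -> R) :
  swapsum l (fun l' => avg m (fun j => f j l')) = avg m (fun j => swapsum l (f j)).
Proof.
revert f; induction l as [|a l IH]; intros f; simpl; [rewrite avg_const; reflexivity|].
rewrite avg_plus. f_equal; [apply (avg_exchange (fun x j => f j (x :: l)))|apply (IH (fun j l' => f j (a :: l')))].
Qed.

Lemma avg_sq_double f : avg m (fun a => avg m (fun k => (f a - f k) ^ 2))
   = 2 * (avg m (fun j => f j ^ 2) - avg m f ^ 2).
Proof.
rewrite (avg_ext _ (fun a => (f a ^ 2 - 2 * avg m f * f a) + avg m (fun k => f k ^ 2))).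
- rewrite avg_plus, avg_minus, avg_scal, avg_const. ring.
- intros a _. rewrite (avg_ext _ (fun k => (f a ^ 2 - 2 * f a * f k) + f k ^ 2)) by (intros; ring).
  rewrite avg_plus, avg_minus, avg_scal, avg_const. ring.
Qed.

(** Law of total variance over the head ball. An independent copy turns its conditional variance
    into half a mean squared difference ([avg_sq_double]); the variance of the conditional mean is
    treated by induction, with Jensen ([avg_sq_le]) taking the average over the head ball out of the
    square. *)
Theorem efron_stein n f :
  Var n f <= / 2 * Ex n (fun l => swapsum l (fun l' => (f l - f l') ^ 2)).
Proof.
revert f; induction n as [|n IH]; intros f.
- rewrite Var_sq, !Ex_0; simpl; lra.
- specialize (IH (fun l => avg m (fun j => f (j :: l)))).
  rewrite Var_sq in *. rewrite !Ex_S; simpl swapsum.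
  rewrite (Ex_ext n (fun l => avg m (fun j => _ + _))
   (fun l => 2 * (avg m (fun j => f (j :: l) ^ 2) - avg m (fun j => f (j :: l)) ^ 2)
     + avg m (fun a => swapsum l (fun l' => (f (a :: l) - f (a :: l')) ^ 2)))).
  2:{ intros l _. rewrite avg_plus. f_equal. exact (avg_sq_double (fun a => f (a :: l))). }
  rewrite Ex_plus, Ex_scal, Ex_minus.
  assert (H : Ex n (fun l => swapsum l (fun l' => (avg m (fun j => f (j :: l)) - avg m (fun j => f (j :: l'))) ^ 2))
    <= Ex n (fun l => avg m (fun a => swapsum l (fun l' => (f (a :: l) - f (a :: l')) ^ 2)))).
  { apply Ex_le; intros l Hl.
    rewrite <- (swapsum_avg l (fun a l' => (f (a :: l) - f (a :: l')) ^ 2)).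
    apply (swapsum_le n); [exact Hl|]. intros l' _.
    rewrite <- avg_minus. apply avg_sq_le. }
  lra.
Qed.

End Uniform.

(** * Occupancy counts and binomial marginals *)

Notation cnt := (count_occ Nat.eq_dec).

Section Counts.

Variable m : nat.
Hypothesis hm : (2 <= m)%nat.

Definition lin (v : nat -> R) (l : list nat) : R := lsum (fun j => v (cnt l j)) (seq 0 m).

Definition diff (v : nat -> R) (k : nat) : R := v (S k) - v k.

Lemma lin_ext n v w l : outcome m n l -> (forall k, (k <= n)%nat -> v k = w k) -> lin v l = lin w l.
Proof.
intros [H _] E; unfold lin; apply lsum_ext; intros; apply E.
rewrite <- H. apply count_occ_bound.
Qed.

Lemma lin_plus v w l : lin (fun k => v k + w k) l = lin v l + lin w l.
Proof. apply lsum_plus. Qed.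

Lemma lin_minus v w l : lin (fun k => v k - w k) l = lin v l - lin w l.
Proof. apply lsum_minus. Qed.

Lemma lin_scal c v l : lin (fun k => c * v k) l = c * lin v l.
Proof. unfold lin; apply lsum_scal. Qed.

Lemma lin_const c l : lin (fun _ => c) l = INR m * c.
Proof. unfold lin; rewrite lsum_const, length_seq; reflexivity. Qed.

Lemma lin_le n v w l : outcome m n l -> (forall k, (k <= n)%nat -> v k <= w k) -> lin v l <= lin w l.
Proof.
intros [H _] E; unfold lin; apply lsum_le; intros; apply E.
rewrite <- H. apply count_occ_bound.
Qed.

Lemma lin_bound n v c l : outcome m n l -> (forall k, (k <= n)%nat -> Rabs (v k) <= c) ->
  Rabs (lin v l) <= INR m * c.
Proof.
intros H E. rewrite <- (lin_const c l). eapply Rle_trans; [apply lsum_Rabs|].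
apply (lin_le n (fun k => Rabs (v k))); assumption.
Qed.

(** Outcomes before and after a move are both compared with the configuration [l1 ++ l2] of the
    other balls; the increment then depends only on two counts taken without the moved ball. *)
Lemma lin_insert v l1 x l2 : (x < m)%nat ->
  lin v (l1 ++ x :: l2) = lin v (l1 ++ l2) + diff v (cnt (l1 ++ l2) x).
Proof.
intros Hx. rewrite <- (lsum_seq_single (fun j => diff v (cnt (l1 ++ l2) j)) m x Hx).
unfold lin. rewrite <- lsum_plus. apply lsum_ext. intros j _.
unfold diff. rewrite !count_occ_app; simpl.
destruct (Nat.eqb_spec j x) as [->|Hne].
- destruct (Nat.eq_dec x x); [|lia]. rewrite <- plus_n_Sm. ring.
- destruct (Nat.eq_dec x j); [lia|ring].
Qed.

Lemma lsum_by_urn n l (Q : nat -> R) : outcome m n l ->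
  lsum Q l = lsum (fun j => INR (cnt l j) * Q j) (seq 0 m).
Proof.
revert n; induction l as [|a l IH]; intros n [H1 H2]; simpl.
- rewrite (lsum_ext _ (fun _ => 0)), lsum_const by (intros; ring). ring.
- rewrite (IH (length l)) by (split; [reflexivity|intros; apply H2; right; assumption]).
  rewrite <- (lsum_seq_single Q m a) by (apply H2; left; reflexivity).
  rewrite <- lsum_plus. apply lsum_ext; intros j _.
  destruct (Nat.eq_dec a j) as [->|Hne].
  + rewrite Nat.eqb_refl, S_INR; ring.
  + destruct (Nat.eqb_spec j a); [lia|ring].
Qed.

Lemma lin_INR n l : outcome m n l -> lin INR l = INR n.
Proof.
intros H. unfold lin. rewrite (lsum_ext _ (fun j => INR (cnt l j) * 1)) by (intros; ring).
rewrite <- (lsum_by_urn n l (fun _ => 1) H), lsum_const. destruct H as [-> _]; ring.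
Qed.

Lemma swapsum_local_le n l h (q : nat -> nat -> R) : outcome m n l ->
  (forall l1 a l2 k, l = l1 ++ a :: l2 -> (k < m)%nat -> h (l1 ++ k :: l2) <= q a k) ->
  swapsum m l h <= lsum (fun a => avg m (q a)) l.
Proof.
revert n h; induction l as [|a l IH]; intros n h [H1 H2] H; simpl; [lra|].
apply Rplus_le_compat.
- apply avg_le; [exact hm|]; intros k Hk. apply (H nil a l k); [reflexivity|exact Hk].
- apply (IH (length l)); [split; [reflexivity|intros; apply H2; right; assumption]|].
  intros l1 b l2 k -> Hk. apply (H (a :: l1) b l2 k); [reflexivity|exact Hk].
Qed.

(** [G] sees the counts without the moved ball: the urn it leaves has one ball fewer, hence [pred],
    and every other urn has its count in [l]. The double sum also contains the void moves k = a,
    with arguments N_a - 1 and N_a; the last term removes them. *)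
Lemma swapsum_pairs_le n l h (G : nat -> nat -> R) : outcome m n l ->
  (forall l1 a l2 k, l = l1 ++ a :: l2 -> (k < m)%nat ->
     h (l1 ++ k :: l2) <=
     if Nat.eqb k a then 0 else G (cnt (l1 ++ l2) a) (cnt (l1 ++ l2) k)) ->
  swapsum m l h <=
    / INR m * lsum (fun j => INR (cnt l j) * lin (G (pred (cnt l j))) l) (seq 0 m)
    - / INR m * lin (fun k => INR k * G (pred k) k) l.
Proof.
intros Hl H.
eapply Rle_trans; [apply (swapsum_local_le n l h (fun a k => G (pred (cnt l a)) (cnt l k)
   - (if Nat.eqb k a then G (pred (cnt l k)) (cnt l k) else 0)) Hl)|].
- intros l1 a l2 k El Hk. eapply Rle_trans; [exact (H l1 a l2 k El Hk)|]. subst l.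
  rewrite !count_occ_app. simpl. destruct (Nat.eq_dec a a); [|lia].
  destruct (Nat.eqb_spec k a) as [->|Hne];
    [destruct (Nat.eq_dec a a); [rewrite <- plus_n_Sm; simpl; lra|lia]|].
  destruct (Nat.eq_dec a k) as [->|_]; [lia|].
  rewrite <- plus_n_Sm. simpl. lra.
- rewrite (lsum_by_urn n l _ Hl). unfold lin at 2. rewrite <- !lsum_scal, <- lsum_minus.
  apply lsum_le; intros j Hj. apply in_seq in Hj. rewrite avg_minus. unfold avg at 2.
  rewrite (lsum_seq_single (fun k => G (pred (cnt l k)) (cnt l k))) by lia.
  unfold avg, lin, Rdiv. right; ring.
Qed.

(* [G (N_a - 1) N_k] is the contribution of moving a ball from urn a to urn k. *)
Lemma swapsum_pairs n l h (G : nat -> nat -> R) : outcome m n l ->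
  (forall i, G i i = 0) ->
  (forall l1 a l2 k, l = l1 ++ a :: l2 -> (k < m)%nat ->
     h (l1 ++ k :: l2) = G (cnt (l1 ++ l2) a) (cnt (l1 ++ l2) k)) ->
  swapsum m l h =
    / INR m * lsum (fun j => INR (cnt l j) * lin (G (pred (cnt l j))) l) (seq 0 m)
    - / INR m * lin (fun k => INR k * G (pred k) k) l.
Proof.
intros Hl G0 H. apply Rle_antisym.
- apply (swapsum_pairs_le n); [exact Hl|]. intros l1 a l2 k El Hk.
  rewrite (H l1 a l2 k El Hk). destruct (Nat.eqb_spec k a) as [->|_]; [rewrite G0|]; lra.
(* The opposite inequality is the same bound for - h with the kernel - G. *)
- apply Ropp_le_cancel.
  replace (- swapsum m l h) with (swapsum m l (fun l' => (-1) * h l')) by (rewrite swapsum_scal; ring).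
  eapply Rle_trans; [apply (swapsum_pairs_le n l _ (fun i k => (-1) * G i k) Hl)|].
  + intros l1 a l2 k El Hk.
    rewrite (H l1 a l2 k El Hk). destruct (Nat.eqb_spec k a) as [->|_]; [rewrite G0|]; lra.
  + right. rewrite (lsum_ext _ (fun j => (-1) * (INR (cnt l j) * lin (G (pred (cnt l j))) l)))
      by (intros; rewrite (lin_scal (-1)); ring).
    rewrite lsum_scal.
    rewrite (lin_ext n (fun k => INR k * (-1 * G (pred k) k)) (fun k => (-1) * (INR k * G (pred k) k)) l Hl)
      by (intros; ring).
    rewrite lin_scal. ring.
Qed.

(** On a linear statistic the chain acts urn by urn, here as minus the generator of a birth and
    death chain: an urn with k balls loses one at rate k (m - 1) / m and gains one at rate (n - k) /
    m. *)
Lemma swapsum_lin n v l : outcome m n l ->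
  swapsum m l (fun l' => lin v l - lin v l') =
  lin (fun k => INR k * (INR m - 1) / INR m * diff v (pred k) - (INR n - INR k) / INR m * diff v k) l.
Proof.
intros Hl. pose proof (mpos m hm) as Hm.
rewrite (swapsum_pairs n l _ (fun i k => diff v i - diff v k) Hl).
- rewrite (lsum_ext _ (fun j => INR m * (INR (cnt l j) * diff v (pred (cnt l j)))
      - lin (diff v) l * INR (cnt l j))).
  2:{ intros j _. rewrite (lin_minus (fun _ => diff v (pred (cnt l j))) (diff v)), lin_const. ring. }
  rewrite lsum_minus, !lsum_scal.
  change (lsum (fun j => INR (cnt l j)) (seq 0 m)) with (lin INR l). rewrite (lin_INR n l Hl).
  change (lsum (fun j => INR (cnt l j) * diff v (pred (cnt l j))) (seq 0 m))
    with (lin (fun k => INR k * diff v (pred k)) l).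
  rewrite Rmult_minus_distr_l, <- Rmult_assoc, Rinv_l, Rmult_1_l by lra.
  rewrite (Rmult_comm (lin (diff v) l)), <- Rmult_assoc, <- !lin_scal, <- !lin_minus.
  apply (lin_ext n); [exact Hl|]. intros k _. field. lra.
- intros; ring.
- intros l1 a l2 k -> Hk. rewrite !lin_insert; [ring|exact Hk|].
  apply Hl. apply in_or_app; right; left; reflexivity.
Qed.

(** Binomial weights with parameters n and 1/m, built ball by ball to follow the recursion [Ex_S];
    the closed form [pb_closed] serves only to match [mu_nm]. With m = 2 they count fair coins. *)
Fixpoint pb (n k : nat) : R :=
  match n with
  | O => match k with O => 1 | S _ => 0 end
  | S n' => (1 - / INR m) * pb n' k + / INR m * match k with O => 0 | S k' => pb n' k' end
  end.

Lemma pb_gt n k : (n < k)%nat -> pb n k = 0.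
Proof.
revert k; induction n as [|n IH]; intros [|k] H; simpl; try lia; [reflexivity|].
rewrite !IH by lia. ring.
Qed.

Lemma invm_bounds : 0 < / INR m <= / 2.
Proof.
pose proof (mpos m hm). split; [apply Rinv_0_lt_compat; lra|apply Rinv_le_contravar; lra].
Qed.

Lemma pb_pos n k : (k <= n)%nat -> 0 < pb n k.
Proof.
pose proof invm_bounds as Hi.
revert k; induction n as [|n IH]; intros k H.
- destruct k; simpl; [lra|lia].
- simpl. destruct k as [|k].
  + specialize (IH 0%nat ltac:(lia)). nra.
  + specialize (IH k ltac:(lia)) as H1.
    destruct (le_lt_dec (S k) n) as [H2|H2].
    * specialize (IH (S k) H2). nra.
    * rewrite (pb_gt n (S k) H2). nra.
Qed.

Lemma pb_nonneg n k : 0 <= pb n k.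
Proof.
destruct (le_lt_dec k n) as [H|H]; [left; apply pb_pos; exact H|rewrite pb_gt by exact H; lra].
Qed.

(** Detailed balance of the birth and death chain of one urn. Free of division and valid for every
    k, it replaces the ratio of binomial coefficients throughout. *)
Lemma pb_balance n k : (INR n - INR k) * pb n k = INR (S k) * (INR m - 1) * pb n (S k).
Proof.
pose proof (mpos m hm).
revert k; induction n as [|n IH]; intros k.
- destruct k; simpl; ring.
- change (pb (S n) (S k)) with ((1 - / INR m) * pb n (S k) + / INR m * pb n k).
  rewrite (Rmult_plus_distr_l (INR (S k) * (INR m - 1))).
  replace (INR (S k) * (INR m - 1) * ((1 - / INR m) * pb n (S k)))
    with ((1 - / INR m) * (INR (S k) * (INR m - 1) * pb n (S k))) by ring.
  rewrite <- IH. destruct k as [|k].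
  + simpl pb. rewrite S_INR. simpl INR. field. lra.
  + specialize (IH k). simpl pb.
    rewrite !S_INR in *.
    transitivity ((1 - / INR m) * ((INR n + 1 - (INR k + 1)) * pb n (S k))
        + / INR m * ((INR n - INR k) * pb n k)); [ring|].
    rewrite IH. field. lra.
Qed.

Definition EB (n : nat) (g : nat -> R) : R := lsum (fun k => pb n k * g k) (seq 0 (S n)).

Lemma EB_ext n f g : (forall k, (k <= n)%nat -> f k = g k) -> EB n f = EB n g.
Proof. intros H; apply lsum_ext; intros k Hk; apply in_seq in Hk; rewrite H by lia; reflexivity. Qed.

Lemma EB_plus n f g : EB n (fun k => f k + g k) = EB n f + EB n g.
Proof. unfold EB; rewrite <- lsum_plus; apply lsum_ext; intros; ring. Qed.

Lemma EB_minus n f g : EB n (fun k => f k - g k) = EB n f - EB n g.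
Proof. unfold EB; rewrite <- lsum_minus; apply lsum_ext; intros; ring. Qed.

Lemma EB_scal n c f : EB n (fun k => c * f k) = c * EB n f.
Proof. unfold EB; rewrite <- lsum_scal; apply lsum_ext; intros; ring. Qed.

Lemma EB_le n f g : (forall k, (k <= n)%nat -> f k <= g k) -> EB n f <= EB n g.
Proof.
intros H; apply lsum_le; intros k Hk; apply in_seq in Hk.
apply Rmult_le_compat_l; [apply pb_nonneg|apply H; lia].
Qed.

Lemma EB_S n g : EB (S n) g = EB n (fun k => (1 - / INR m) * g k + / INR m * g (S k)).
Proof.
rewrite EB_plus, !EB_scal. unfold EB.
rewrite (lsum_ext _ (fun k => (1 - / INR m) * (pb n k * g k)
  + / INR m * (match k with O => 0 | S k' => pb n k' end * g k))) by (intros; simpl; ring).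
rewrite lsum_plus, !lsum_scal. f_equal.
- rewrite (seq_S (S n)), lsum_app. simpl lsum at 2. rewrite pb_gt by lia. ring.
- rewrite <- (lsum_map (fun k => match k with O => 0 | S k' => pb n k' end * g k) S).
  rewrite seq_shift. simpl. ring.
Qed.

Lemma EB_const n c : EB n (fun _ => c) = c.
Proof.
induction n as [|n IH]; [unfold EB; simpl; ring|].
rewrite EB_S, EB_plus, !EB_scal, IH. pose proof (mpos m hm); field; lra.
Qed.

(** Detailed balance summed over k; the boundary terms at 0 and n + 1 vanish. *)
Lemma EB_shift n g :
  EB n (fun k => (INR n - INR k) * g (S k)) = (INR m - 1) * EB n (fun k => INR k * g k).
Proof.
unfold EB. rewrite <- lsum_scal.
transitivity (lsum (fun k => pb n k * (INR m - 1) * INR k * g k) (seq 0 (S (S n)))).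
- change (seq 0 (S (S n))) with (0%nat :: seq 1 (S n)).
  rewrite lsum_cons, <- seq_shift, lsum_map.
  replace (pb n 0 * (INR m - 1) * INR 0 * g 0%nat) with 0 by (simpl INR; ring).
  rewrite Rplus_0_l. apply lsum_ext; intros k _.
  transitivity (((INR n - INR k) * pb n k) * g (S k)); [ring|]. rewrite pb_balance. ring.
- rewrite (seq_S (S n)), lsum_app, lsum_cons, Nat.add_0_l, (pb_gt n (S n)) by lia.
  rewrite !Rmult_0_l, !Rplus_0_l. unfold lsum at 2; simpl fold_right. rewrite Rplus_0_r. apply lsum_ext; intros; ring.
Qed.

Lemma EB_INR n : EB n INR = INR n / INR m.
Proof.
pose proof (mpos m hm). generalize (EB_shift n (fun _ => 1)).
rewrite (EB_ext n (fun k => (INR n - INR k) * 1) (fun k => INR n - INR k)) by (intros; ring).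
rewrite (EB_ext n (fun k => INR k * 1) INR) by (intros; ring).
rewrite EB_minus, EB_const. intros E.
apply (Rmult_eq_reg_l (INR m)); [|lra]. field_simplify; lra.
Qed.

Lemma EB_single n a f : EB n (fun k => if Nat.eqb k a then f k else 0) = pb n a * f a.
Proof.
destruct (le_lt_dec a n) as [H|H].
- unfold EB. rewrite <- (lsum_seq_single (fun k => pb n k * f k) (S n) a) by lia.
  apply lsum_ext; intros k _. destruct (Nat.eqb k a); ring.
- rewrite pb_gt by exact H. rewrite (EB_ext n _ (fun _ => 0)), EB_const; [ring|].
  intros k Hk; destruct (Nat.eqb_spec k a); [lia|reflexivity].
Qed.

Lemma Ex_cnt n j g : (j < m)%nat -> Ex m n (fun l => g (cnt l j)) = EB n g.
Proof.
intros Hj; revert g; induction n as [|n IH]; intros g.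
- rewrite Ex_0. unfold EB; simpl; ring.
- rewrite (Ex_S m hm), EB_S, <- IH. apply Ex_ext; [exact hm|]; intros l _.
  unfold avg. rewrite (lsum_ext _ (fun k => g (cnt l j)
    + (if Nat.eqb k j then g (S (cnt l j)) - g (cnt l j) else 0))).
  + rewrite lsum_plus, lsum_const, length_seq, (lsum_seq_single (fun _ => _)) by exact Hj.
    pose proof (mpos m hm); field; lra.
  + intros k _. simpl. destruct (Nat.eq_dec k j), (Nat.eqb_spec k j); try lia; ring.
Qed.

Lemma Ex_lin n v : Ex m n (lin v) = INR m * EB n v.
Proof.
unfold lin. rewrite Ex_lsum by exact hm.
rewrite (lsum_ext _ (fun _ => EB n v)).
- rewrite lsum_const, length_seq; reflexivity.
- intros j Hj; apply in_seq in Hj; apply Ex_cnt; lia.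
Qed.

(** Efron-Stein expressed by values of [v] instead of increments: a [v] concentrated near d gives a
    bound proportional to the binomial weights there. [EB_shift] folds the squared values at k + 1
    back to k, which is the origin of the weight [INR k]. *)
Lemma Var_lin_le n v :
  Var m n (lin v) <= 4 * INR m * EB n (fun k => (INR k + 2 * (INR n / INR m)) * v k ^ 2).
Proof.
pose proof (mpos m hm) as Hm.
eapply Rle_trans; [apply efron_stein; exact hm|].
set (u := fun k : nat => v (S k) ^ 2 + v k ^ 2).
assert (H : forall l, outcome m n l ->
  swapsum m l (fun l' => (lin v l - lin v l') ^ 2) <=
  4 * lin (fun k => INR k * u (pred k) + / INR m * ((INR n - INR k) * u k)) l
  - 4 / INR m * lin (fun k => INR k * u (pred k)) l).
{ intros l Hl.
  eapply Rle_trans; [apply (swapsum_pairs_le n l _ (fun i k => 4 * (u i + u k)) Hl)|].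
  - intros l1 a l2 k El Hk. rewrite El at 1. rewrite !lin_insert;
      [|exact Hk|apply Hl; rewrite El; apply in_or_app; right; left; reflexivity].
    destruct (Nat.eqb_spec k a) as [->|_].
    + right; ring.
    + unfold diff, u.
      generalize (v (S (cnt (l1 ++ l2) a))), (v (cnt (l1 ++ l2) a)),
        (v (S (cnt (l1 ++ l2) k))), (v (cnt (l1 ++ l2) k)). intros x y z t.
      (* Cauchy-Schwarz for four terms: 4 (x^2 + y^2 + z^2 + t^2) - (x - y - z + t)^2 is the sum of
         these six squares. *)
      generalize (pow2_ge_0 (x + y)), (pow2_ge_0 (x + z)), (pow2_ge_0 (x - t)),
       (pow2_ge_0 (y - z)), (pow2_ge_0 (y + t)), (pow2_ge_0 (z + t)). nra.
  - rewrite (lsum_ext _ (fun j => (4 * INR m) * (INR (cnt l j) * u (pred (cnt l j)))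
      + (4 * lin u l) * INR (cnt l j))).
    2:{ intros j _. rewrite lin_scal, (lin_plus (fun _ => u (pred (cnt l j))) u), lin_const. ring. }
    rewrite lsum_plus, !lsum_scal.
    change (lsum (fun j => INR (cnt l j)) (seq 0 m)) with (lin INR l). rewrite (lin_INR n l Hl).
    change (lsum (fun j => INR (cnt l j) * u (pred (cnt l j))) (seq 0 m))
      with (lin (fun k => INR k * u (pred k)) l).
    rewrite lin_plus, lin_scal.
    rewrite (lin_ext n (fun k => (INR n - INR k) * u k) (fun k => INR n * u k - INR k * u k) l Hl)
      by (intros; ring).
    rewrite (lin_ext n (fun k => INR k * (4 * (u (pred k) + u k)))
      (fun k => 4 * (INR k * u (pred k)) + 4 * (INR k * u k)) l Hl) by (intros; ring).
    rewrite lin_minus, lin_plus, !lin_scal. right. field. lra. }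
assert (H2 : Ex m n (fun l => swapsum m l (fun l' => (lin v l - lin v l') ^ 2))
  <= 4 * (INR m * (EB n (fun k => INR k * u (pred k)) + / INR m * EB n (fun k => (INR n - INR k) * u k)))
     - 4 * EB n (fun k => INR k * u (pred k))).
{ eapply Rle_trans; [apply Ex_le; [exact hm|]; exact H|].
  rewrite Ex_minus, !Ex_scal, !Ex_lin, EB_plus, EB_scal. right; field; lra. }
assert (E1 : (INR m - 1) * EB n (fun k => INR k * u (pred k)) = EB n (fun k => (INR n - INR k) * u k)).
{ rewrite <- (EB_shift n (fun k => u (pred k))). reflexivity. }
assert (E2 : EB n (fun k => (INR n - INR k) * u k) =
   (INR m - 1) * EB n (fun k => INR k * v k ^ 2) + EB n (fun k => (INR n - INR k) * v k ^ 2)).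
{ rewrite <- (EB_shift n (fun k => v k ^ 2)), <- EB_plus. apply EB_ext; intros; unfold u; ring. }
assert (E3 : EB n (fun k => (INR n - INR k) * v k ^ 2) <= INR n * EB n (fun k => v k ^ 2)).
{ rewrite <- EB_scal. apply EB_le; intros k _.
  generalize (pos_INR k), (pow2_ge_0 (v k)); nra. }
rewrite (EB_ext n _ (fun k => INR k * v k ^ 2 + 2 * (INR n / INR m) * v k ^ 2)) by (intros; ring).
rewrite EB_plus, EB_scal.
set (X := EB n (fun k => INR k * v k ^ 2)) in *.
set (Y := EB n (fun k => v k ^ 2)) in *.
set (Z := EB n (fun k => (INR n - INR k) * v k ^ 2)) in *.
set (T := EB n (fun k => INR k * u (pred k))) in *.
set (V := EB n (fun k => (INR n - INR k) * u k)) in *.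
assert (HX : 0 <= X).
{ unfold X. rewrite <- (EB_const n 0). apply EB_le; intros k _.
  generalize (pos_INR k), (pow2_ge_0 (v k)); nra. }
replace (4 * INR m * (X + 2 * (INR n / INR m) * Y)) with (4 * INR m * X + 8 * (INR n * Y)) by (field; lra).
replace (4 * (INR m * (T + / INR m * V)) - 4 * T) with (4 * ((INR m - 1) * T) + 4 * V) in H2 by (field; lra).
assert (HY : 0 <= INR n * Y).
{ unfold Y. rewrite <- EB_scal, <- (EB_const n 0). apply EB_le; intros k _.
  generalize (pos_INR n), (pow2_ge_0 (v k)); nra. }
rewrite E1, E2 in H2. lra.
Qed.

End Counts.

(** * The Poisson equation of a single urn *)

Section BinomialStein.

Variable m : nat.
Hypothesis hm : (2 <= m)%nat.
Variable n : nat.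

Notation pi := (pb m n).

(** The ratio pi (k + 1) / pi k decreases by [pb_balance], which gives s = 1; moving one unit at a
    time from the larger index to the smaller gives the general case. The product form allows for
    weights vanishing beyond n. *)
Lemma pb_logconcave a b s : (a <= b)%nat -> pi a * pi (b + s) <= pi (a + s) * pi b.
Proof.
pose proof (mpos m hm) as Hm.
assert (step : forall a b, (a <= b)%nat -> pi a * pi (S b) <= pi (S a) * pi b).
{ clear a b s; intros a b Hab.
  destruct (le_lt_dec n b) as [Hb|Hb].
  { rewrite (pb_gt m hm n (S b)) by lia. generalize (pb_nonneg m hm n (S a)), (pb_nonneg m hm n b). nra. }
  pose proof (pb_balance m hm n a) as Ea. pose proof (pb_balance m hm n b) as Eb.
  rewrite !S_INR in *.
  assert (Ha' : INR a <= INR b) by (apply le_INR; exact Hab).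
  assert (Hb' : INR b + 1 <= INR n) by (rewrite <- S_INR; apply le_INR; lia).
  pose proof (pos_INR a). pose proof (pos_INR b).
  apply (Rmult_le_reg_l ((INR n - INR a) * ((INR b + 1) * (INR m - 1)))).
  { apply Rmult_lt_0_compat; [lra|]. apply Rmult_lt_0_compat; lra. }
  transitivity ((INR n - INR a) * pi a * ((INR b + 1) * (INR m - 1) * pi (S b))); [right; ring|].
  rewrite Ea, <- Eb.
  transitivity ((INR m - 1) * (pi (S a) * pi b) * ((INR a + 1) * (INR n - INR b))); [right; ring|].
  transitivity ((INR m - 1) * (pi (S a) * pi b) * ((INR b + 1) * (INR n - INR a))); [|right; ring].
  apply Rmult_le_compat_l.
  - generalize (pb_nonneg m hm n (S a)), (pb_nonneg m hm n b); intros.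
    apply Rmult_le_pos; [lra|apply Rmult_le_pos; assumption].
  - nra. }
revert a; induction s as [|s IH]; intros a Hab.
- rewrite !Nat.add_0_r. lra.
- destruct (Nat.eq_dec a b) as [->|Hne]; [right; ring|].
  eapply Rle_trans; [rewrite <- plus_n_Sm; apply step; lia|].
  replace (a + S s)%nat with (S a + s)%nat by lia. apply IH; lia.
Qed.

Lemma pb_sum : lsum pi (seq 0 (S n)) = 1.
Proof.
rewrite <- (EB_const m hm n 1). unfold EB. apply lsum_ext; intros; ring.
Qed.

Lemma pb_sum_le s c : lsum pi (seq s c) <= 1.
Proof.
assert (P : forall s c, 0 <= lsum pi (seq s c)) by (intros; apply lsum_nonneg; intros; apply pb_nonneg; exact hm).
assert (Q : lsum pi (seq 0 (s + c)) = lsum pi (seq 0 s) + lsum pi (seq s c)).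
{ rewrite seq_app, lsum_app; reflexivity. }
assert (Q2 : lsum pi (seq 0 (s + c + S n)) = lsum pi (seq 0 (s + c)) + lsum pi (seq (s + c) (S n))).
{ rewrite seq_app, lsum_app; reflexivity. }
assert (Q3 : lsum pi (seq 0 (s + c + S n)) = 1).
{ replace (s + c + S n)%nat with (S n + (s + c))%nat by lia.
  rewrite seq_app, lsum_app, pb_sum, (lsum_ext _ (fun _ => 0)), lsum_const; [ring|].
  intros x Hx; apply in_seq in Hx; apply pb_gt; lia. }
generalize (P 0%nat s), (P (s + c)%nat (S n)). lra.
Qed.

Variable d : nat.
Hypothesis hd : (2 <= d)%nat.
Hypothesis hn : (d <= n)%nat.

Definition binF (k : nat) : R := lsum pi (seq 0 (S k)).

(** Minus the sum of pi i * (1_(i = d) - pi d) over i <= k, written with a definite sign on each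
    side of d. It is the flux across the edge from k to k + 1 in the Poisson equation of one urn. *)
Definition steinX (k : nat) : R :=
  if Nat.ltb k d then pi d * binF k else - (pi d * (1 - binF k)).

(* Increment of the solution of the Poisson equation, for the indicator of d, of the chain describing a single urn. *)
Definition steinD (k : nat) : R :=
  if Nat.ltb k n then INR m / (INR m - 1) * (steinX k / (INR (S k) * pi (S k))) else 0.

(** By log-concavity, pi d * pi i <= pi (k + 1) * pi (i + d - k - 1), both for i <= k < d and for i
    > k >= d. Summing over the relevant tail leaves pi (k + 1) times a sum of distinct weights,
    which is at most 1. *)
Lemma steinX_bound k : (k < n)%nat -> Rabs (steinX k) <= pi (S k).
Proof.
intros Hk. unfold steinX. destruct (Nat.ltb_spec k d) as [H|H].
- rewrite Rabs_pos_eq.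
  2:{ apply Rmult_le_pos; [apply pb_nonneg, hm|apply lsum_nonneg; intros; apply pb_nonneg, hm]. }
  unfold binF. rewrite <- lsum_scal.
  apply (Rle_trans _ (lsum (fun i => pi (S k) * pi (d - S k + i)) (seq 0 (S k)))).
  + apply lsum_le; intros i Hi; apply in_seq in Hi.
    generalize (pb_logconcave i (d - S k + i) (S k - i) ltac:(lia)).
    replace (d - S k + i + (S k - i))%nat with d by lia.
    replace (i + (S k - i))%nat with (S k) by lia. lra.
  + rewrite lsum_scal, lsum_seq_shift.
    generalize (pb_sum_le (d - S k) (S k)), (pb_nonneg m hm n (S k)). nra.
- assert (E : 1 - binF k = lsum (fun t => pi (S k + t)) (seq 0 (n - k))).
  { rewrite <- pb_sum. unfold binF. replace (S n) with (S k + (n - k))%nat at 1 by lia.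
    rewrite seq_app, lsum_app, Nat.add_0_l.
    rewrite lsum_seq_shift; ring. }
  rewrite Rabs_Ropp, E. rewrite Rabs_pos_eq.
  2:{ apply Rmult_le_pos; [apply pb_nonneg, hm|apply lsum_nonneg; intros; apply pb_nonneg, hm]. }
  rewrite <- lsum_scal.
  apply (Rle_trans _ (lsum (fun t => pi (S k) * pi (d + t)) (seq 0 (n - k)))).
  + apply lsum_le; intros t _.
    generalize (pb_logconcave d (d + t) (S k - d) ltac:(lia)).
    replace (d + t + (S k - d))%nat with (S k + t)%nat by lia.
    replace (d + (S k - d))%nat with (S k) by lia. lra.
  + rewrite lsum_scal.
    rewrite lsum_seq_shift. generalize (pb_sum_le d (n - k)), (pb_nonneg m hm n (S k)). nra.
Qed.

Lemma m_ratio_bounds : 0 < INR m / (INR m - 1) <= 2.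
Proof.
pose proof (mpos m hm). split; [apply Rdiv_lt_0_compat; lra|].
apply (Rmult_le_reg_r (INR m - 1)); [lra|]. unfold Rdiv. rewrite Rmult_assoc, Rinv_l; lra.
Qed.

Lemma steinD_bound k : INR (S k) * Rabs (steinD k) <= 2.
Proof.
pose proof m_ratio_bounds as Hr. unfold steinD. destruct (Nat.ltb_spec k n) as [H|H].
- assert (HS : 0 < INR (S k)) by (apply lt_0_INR; lia).
  pose proof (pb_pos m hm n (S k) H) as Hp.
  pose proof (steinX_bound k H) as Hx.
  unfold Rdiv at 2. rewrite !Rabs_mult, Rabs_inv, (Rabs_pos_eq (INR m / (INR m - 1))), (Rabs_pos_eq (INR (S k) * _)).
  2:{ apply Rmult_le_pos; lra. } 2: lra.
  replace (INR (S k) * _) with (INR m / (INR m - 1) * (Rabs (steinX k) * / pi (S k))) 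
    by (field; pose proof (mpos m hm); repeat split; lra).
  assert (Rabs (steinX k) * / pi (S k) <= 1).
  { apply (Rmult_le_reg_r (pi (S k))); [exact Hp|]. rewrite Rmult_assoc, Rinv_l; lra. }
  assert (0 <= Rabs (steinX k) * / pi (S k)).
  { apply Rmult_le_pos; [apply Rabs_pos|left; apply Rinv_0_lt_compat; exact Hp]. }
  nra.
- rewrite Rabs_R0. lra.
Qed.

Lemma steinD_bound' k : Rabs (steinD k) <= 2.
Proof.
generalize (steinD_bound k). rewrite S_INR. generalize (pos_INR k), (Rabs_pos (steinD k)). nra.
Qed.

Lemma steinD_up k : (k <= n)%nat -> (INR n - INR k) / INR m * steinD k = steinX k / pi k.
Proof.
intros Hk. pose proof (mpos m hm). unfold steinD. destruct (Nat.ltb_spec k n) as [H1|H1].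
- pose proof (pb_balance m hm n k) as E.
  pose proof (pb_pos m hm n k Hk). pose proof (pb_pos m hm n (S k) H1).
  assert (0 < INR (S k)) by (apply lt_0_INR; lia).
  transitivity (steinX k * ((INR n - INR k) * pi k) / (pi k * ((INR m - 1) * INR (S k) * pi (S k)))).
  + field. repeat split; lra.
  + rewrite E. field. repeat split; lra.
(* At k = n the increment is 0 by definition, in agreement with [binF n] = 1 and d <= n. *)
- replace k with n by lia. unfold steinX, binF. rewrite pb_sum.
  destruct (Nat.ltb_spec n d); [lia|]. unfold Rdiv; ring.
Qed.

Lemma steinD_down k : (S k <= n)%nat -> INR (S k) * (INR m - 1) / INR m * steinD k = steinX k / pi (S k).
Proof.
intros Hk. pose proof (mpos m hm). unfold steinD. destruct (Nat.ltb_spec k n) as [H1|H1]; [|lia].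
pose proof (pb_pos m hm n (S k) H1).
assert (0 < INR (S k)) by (apply lt_0_INR; lia).
field. repeat split; lra.
Qed.

Definition indic (a k : nat) : R := if Nat.eqb k a then 1 else 0.

(** By [steinD_up] and [steinD_down] the left side is (steinX (k - 1) - steinX k) / pi k, with flux
    0 to the left of 0, and the flux drops by pi k * (1_(k = d) - pi d) at k. *)
Lemma steinD_eq k : (k <= n)%nat ->
  INR k * (INR m - 1) / INR m * steinD (pred k) - (INR n - INR k) / INR m * steinD k = indic d k - pi d.
Proof.
intros Hk. rewrite steinD_up by exact Hk. pose proof (pb_pos m hm n k Hk) as Hp.
destruct k as [|k].
- unfold steinX, binF, indic. destruct (Nat.ltb_spec 0 d); [|lia].
  destruct (Nat.eqb_spec 0 d); [lia|]. unfold lsum; simpl fold_right. simpl INR. field. pose proof (mpos m hm); split; lra.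
- simpl pred. rewrite steinD_down by exact Hk.
  assert (E : binF (S k) = binF k + pi (S k)).
  { unfold binF. rewrite (seq_S (S k)), lsum_app. simpl. ring. }
  unfold steinX, indic. rewrite E.
  destruct (Nat.ltb_spec k d); destruct (Nat.ltb_spec (S k) d);
    destruct (Nat.eqb_spec (S k) d) as [Ed|Ed]; try lia; rewrite <- ?Ed; field; lra.
Qed.

Definition steinPhi (k : nat) : R := lsum steinD (seq 0 k).

Lemma diff_steinPhi k : diff steinPhi k = steinD k.
Proof. unfold diff, steinPhi. rewrite seq_S, lsum_app; simpl; ring. Qed.

Lemma poisson_equation l : outcome m n l ->
  swapsum m l (fun l' => lin m steinPhi l - lin m steinPhi l') = lin m (indic d) l - INR m * pi d.
Proof.
intros Hl. rewrite (swapsum_lin m hm n _ _ Hl), <- (lin_const m (pi d) l), <- lin_minus.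
apply (lin_ext m n); [exact Hl|]. intros k Hk. rewrite !diff_steinPhi. apply steinD_eq; exact Hk.
Qed.

End BinomialStein.

(** * The normal distribution function *)

Notation npdf := std_normal_density.

Lemma sqrt_2PI_pos : 0 < sqrt (2 * PI).
Proof. apply sqrt_lt_R0. generalize PI_RGT_0; lra. Qed.

Lemma npdf_pos x : 0 < npdf x.
Proof. apply Rdiv_lt_0_compat; [apply exp_pos|apply sqrt_2PI_pos]. Qed.

Lemma npdf_opp x : npdf (- x) = npdf x.
Proof. unfold std_normal_density; do 2 f_equal; field. Qed.

Lemma npdf_derive x : is_derive npdf x (- x * npdf x).
Proof.
unfold std_normal_density. generalize sqrt_2PI_pos; intros H.
auto_derive; [exact I|].
replace (- (x * (x * 1)) * / 2) with (- x ^ 2 / 2) by (simpl; field). simpl; field. lra.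
Qed.

Lemma derivable_pt_lim_eq f x l l' : derivable_pt_lim f x l -> l = l' -> derivable_pt_lim f x l'.
Proof. intros H <-; exact H. Qed.

Lemma derivable_increasing_le (f f' : R -> R) a b : a <= b ->
  (forall x, a <= x <= b -> derivable_pt_lim f x (f' x)) ->
  (forall x, a <= x <= b -> 0 <= f' x) -> f a <= f b.
Proof.
intros Hab Hd Hp. destruct Hab as [Hab| ->]; [|lra].
destruct (MVT_cor2 f f' a b Hab Hd) as [c [E Hc]].
specialize (Hp c ltac:(lra)). nra.
Qed.

Section GaussianIntegral.

(* The Gaussian integral enters as [Phi 0 = 1/2]: the derivative of [PI * (Phi x - Phi 0)^2 + RInt (gk x) 0 1]
   vanishes, the second term is PI / 4 at 0, and it tends to 0 at infinity. *)

Definition gk (x t : R) : R := exp (- (x ^ 2 * (1 + t ^ 2) / 2)) / (1 + t ^ 2).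

Lemma gk_derive x t : is_derive (fun u => gk u t) x (- x * exp (- (x ^ 2 * (1 + t ^ 2) / 2))).
Proof.
unfold gk. assert (0 < 1 + t ^ 2) by (generalize (pow2_ge_0 t); lra).
auto_derive; [simpl in H; lra|].
replace (- (x * (x * 1) * (1 + t * (t * 1)) * / 2)) with (- (x ^ 2 * (1 + t ^ 2) / 2)) by (simpl; field).
simpl. field. simpl in H. lra.
Qed.

Lemma gk_continuous x t : continuous (gk x) t.
Proof.
apply (ex_derive_continuous (gk x)). unfold gk.
assert (0 < 1 + t ^ 2) by (generalize (pow2_ge_0 t); lra).
auto_derive. lra.
Qed.

Lemma gk_RInt_derive x :
  is_derive (fun y => RInt (gk y) 0 1) x (- x * exp (- (x ^ 2 / 2)) * RInt (fun t => exp (- (x ^ 2 * t ^ 2 / 2))) 0 1).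
Proof.
replace (- x * exp (- (x ^ 2 / 2)) * _) with (RInt (fun t => Derive (fun u => gk u t) x) 0 1).
- apply (is_derive_RInt_param (fun y t => gk y t)).
  + exists (mkposreal 1 Rlt_0_1). intros y _ t _. eexists. apply gk_derive.
  + intros t _. apply (continuity_2d_pt_ext (fun u v => - u * exp (- (u ^ 2 * (1 + v ^ 2) / 2)))).
    * intros u v. symmetry. apply is_derive_unique. apply gk_derive.
    * apply continuity_2d_pt_mult; [apply continuity_2d_pt_opp, continuity_2d_pt_id1|].
      apply (continuity_1d_2d_pt_comp exp (fun u v => - (u ^ 2 * (1 + v ^ 2) / 2))).
      { apply derivable_continuous_pt, derivable_pt_exp. }
      apply continuity_2d_pt_opp.
      apply (continuity_2d_pt_ext (fun u v => (u * u) * ((1 + v * v) * / 2))).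
      { intros; simpl; field. }
      repeat (apply continuity_2d_pt_mult || apply continuity_2d_pt_plus || apply continuity_2d_pt_const
        || apply continuity_2d_pt_id1 || apply continuity_2d_pt_id2).
  + exists (mkposreal 1 Rlt_0_1). intros y _. apply (@ex_RInt_continuous R_CompleteNormedModule).
    intros; apply gk_continuous.
- rewrite <- (RInt_scal (V := R_CompleteNormedModule)).
  + apply RInt_ext. intros t _. etransitivity; [apply is_derive_unique, gk_derive|].
    unfold scal; simpl; unfold mult; simpl.
    rewrite (Rmult_assoc (- x) (exp _) (exp _)), <- exp_plus. do 2 f_equal. field.
  + apply (@ex_RInt_continuous R_CompleteNormedModule). intros t _.
    apply (ex_derive_continuous (fun t => exp (- (x ^ 2 * t ^ 2 / 2)))). auto_derive. exact I.
Qed.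

Lemma gk_RInt_0 : RInt (gk 0) 0 1 = PI / 4.
Proof.
rewrite (RInt_ext (gk 0) (fun t => / (1 + t ^ 2))).
- rewrite <- atan_1. replace (atan 1) with (minus (atan 1) (atan 0)).
  + apply is_RInt_unique. apply (is_RInt_derive atan).
    * intros x _. apply is_derive_Reals.
      apply derivable_pt_lim_atan.
    * intros x _. apply (ex_derive_continuous (fun t => / (1 + t ^ 2))).
      auto_derive. generalize (pow2_ge_0 x); simpl; lra.
  + rewrite atan_0. change (atan 1 + - 0 = atan 1). ring.
- intros t _. unfold gk. replace (- (0 ^ 2 * (1 + t ^ 2) / 2)) with 0 by field.
  rewrite exp_0. apply Rmult_1_l.
Qed.

Lemma gk_RInt_bounds x : 0 <= RInt (gk x) 0 1 <= exp (- (x ^ 2 / 2)).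
Proof.
assert (E : ex_RInt (gk x) 0 1).
{ apply (@ex_RInt_continuous R_CompleteNormedModule). intros; apply gk_continuous. }
split.
- apply RInt_ge_0; [lra|exact E|]. intros t _. unfold gk.
  apply Rdiv_le_0_compat; [left; apply exp_pos|generalize (pow2_ge_0 t); lra].
- replace (exp (- (x ^ 2 / 2))) with (RInt (fun _ => exp (- (x ^ 2 / 2))) 0 1).
  + apply RInt_le; [lra|exact E|apply ex_RInt_const|]. intros t _. unfold gk.
    assert (H : 1 <= 1 + t ^ 2) by (generalize (pow2_ge_0 t); lra).
    apply (Rmult_le_reg_r (1 + t ^ 2)); [lra|]. unfold Rdiv at 1. rewrite Rmult_assoc, Rinv_l, Rmult_1_r by lra.
    apply (Rle_trans _ (exp (- (x ^ 2 / 2)) * 1)).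
    * rewrite Rmult_1_r. destruct (Req_dec (x ^ 2 * t ^ 2) 0) as [E0|N0].
      { right. f_equal. replace (x ^ 2 * (1 + t ^ 2)) with (x ^ 2 + x ^ 2 * t ^ 2) by ring. rewrite E0. f_equal; field. }
      left. apply exp_increasing. generalize (pow2_ge_0 x), (pow2_ge_0 t). intros. nra.
    * apply Rmult_le_compat_l; [left; apply exp_pos|exact H].
  + rewrite RInt_const. unfold scal; simpl; unfold mult; simpl; ring.
Qed.

Variable Phi : R -> R.
Hypothesis hPhi : is_std_normal_cdf Phi.

Lemma Phi_derive x : is_derive Phi x (npdf x).
Proof. apply is_derive_Reals, (proj1 hPhi). Qed.

Lemma Phi_increasing x y : x <= y -> Phi x <= Phi y.
Proof.
intros H. apply (derivable_increasing_le Phi npdf); [exact H|intros; apply (proj1 hPhi)|].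
intros; left; apply npdf_pos.
Qed.

Lemma Phi_nonneg x : 0 <= Phi x.
Proof.
destruct (Rle_lt_dec 0 (Phi x)) as [H|H]; [exact H|exfalso].
destruct (proj2 hPhi (- Phi x) ltac:(lra)) as [M HM].
specialize (HM (Rmin (M - 1) x)). 
assert (H1 : Rmin (M - 1) x < M) by (generalize (Rmin_l (M - 1) x); lra).
generalize (HM H1), (Phi_increasing (Rmin (M - 1) x) x (Rmin_r _ _)).
unfold Rabs; destruct (Rcase_abs _); lra.
Qed.

Lemma Phi_gk_const x : PI * (Phi x - Phi 0) ^ 2 + RInt (gk x) 0 1 = PI / 4.
Proof.
assert (D : forall y, derivable_pt_lim (fun y => PI * (Phi y - Phi 0) ^ 2 + RInt (gk y) 0 1) y 0).
{ intros y.
  (* Substitution s = y * t in the integral of the density from 0 to y. *)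
  assert (HS : y * RInt (fun t => exp (- (y ^ 2 * t ^ 2 / 2))) 0 1 = sqrt (2 * PI) * (Phi y - Phi 0)).
  { rewrite <- (RInt_scal (V := R_CompleteNormedModule)).
    - apply is_RInt_unique.
      replace (sqrt (2 * PI) * (Phi y - Phi 0))
        with (minus (sqrt (2 * PI) * Phi (y * 1)) (sqrt (2 * PI) * Phi (y * 0))).
      2:{ rewrite Rmult_1_r, Rmult_0_r. unfold minus, plus, opp; simpl; ring. }
      apply (is_RInt_derive (fun t => sqrt (2 * PI) * Phi (y * t))).
      + intros t _. change (scal y (exp (- (y ^ 2 * t ^ 2 / 2)))) with (y * exp (- (y ^ 2 * t ^ 2 / 2))).
        replace (y * exp (- (y ^ 2 * t ^ 2 / 2))) with (sqrt (2 * PI) * (y * npdf (y * t))).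
        * apply (is_derive_scal (fun t => Phi (y * t))).
          apply (is_derive_comp Phi (fun t => y * t) t (npdf (y * t)) y); [apply Phi_derive|].
          auto_derive; [exact I|ring].
        * unfold std_normal_density. replace (- (y * t) ^ 2 / 2) with (- (y ^ 2 * t ^ 2 / 2)) by field.
          field. generalize sqrt_2PI_pos; lra.
      + intros t _. apply (ex_derive_continuous (fun t => scal y (exp (- (y ^ 2 * t ^ 2 / 2))))).
        unfold scal; simpl; unfold mult; simpl. auto_derive. exact I.
    - apply (@ex_RInt_continuous R_CompleteNormedModule). intros t _.
      apply (ex_derive_continuous (fun t => exp (- (y ^ 2 * t ^ 2 / 2)))). auto_derive. exact I. }
  apply (derivable_pt_lim_eq _ _ (PI * (2 * (Phi y - Phi 0) * npdf y)
     + (- y * exp (- (y ^ 2 / 2)) * RInt (fun t => exp (- (y ^ 2 * t ^ 2 / 2))) 0 1))).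
  - apply is_derive_Reals. apply (is_derive_plus (fun y => PI * (Phi y - Phi 0) ^ 2) (fun y => RInt (gk y) 0 1)); [|apply gk_RInt_derive].
    apply (is_derive_scal (fun y => (Phi y - Phi 0) ^ 2)).
    generalize (Phi_derive y); intros Hd.
    auto_derive; [exists (npdf y); exact Hd|].
    replace (Derive (fun x => Phi x) y) with (npdf y) by (symmetry; apply is_derive_unique; exact Hd). ring.
  - unfold std_normal_density. replace (- y ^ 2 / 2) with (- (y ^ 2 / 2)) by field.
    assert (Q : sqrt (2 * PI) * sqrt (2 * PI) = 2 * PI) by (apply sqrt_sqrt; generalize PI_RGT_0; lra).
    generalize sqrt_2PI_pos; intros Hs.
    set (J := RInt (fun t => exp (- (y ^ 2 * t ^ 2 / 2))) 0 1 : R) in *.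
    change (RInt (fun t => exp (- (y ^ 2 * t ^ 2 / 2))) 0 1) with J. clearbody J.
    generalize dependent (sqrt (2 * PI)); intros s HS Q Hs.
    transitivity (2 * PI * (Phi y - Phi 0) * exp (- (y ^ 2 / 2)) / s
      - exp (- (y ^ 2 / 2)) * (y * J)).
    { field. lra. }
    rewrite HS, <- Q. field. lra. }
assert (C : forall a b, a < b -> PI * (Phi a - Phi 0) ^ 2 + RInt (gk a) 0 1 = PI * (Phi b - Phi 0) ^ 2 + RInt (gk b) 0 1).
{ intros a b Hab.
  destruct (MVT_cor2 (fun y => PI * (Phi y - Phi 0) ^ 2 + RInt (gk y) 0 1) (fun _ => 0) a b Hab) as [c [E _]].
  - intros; apply D.
  - lra. }
rewrite <- gk_RInt_0.
destruct (Rtotal_order x 0) as [H|[->|H]].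
- rewrite (C x 0 H). ring.
- ring.
- rewrite <- (C 0 x H). ring.
Qed.

(** Let x tend to minus infinity in [Phi_gk_const]: both [Phi x] and the integral vanish, leaving PI
    * Phi 0 ^ 2 = PI / 4, and [Phi 0] is nonnegative. *)
Lemma Phi_0 : Phi 0 = / 2.
Proof.
generalize (Phi_nonneg 0); intros H0.
assert (HP : 1 < PI) by (generalize PI2_1; lra).
assert (K : Phi 0 ^ 2 = / 4).
{ apply Rminus_diag_uniq. apply cond_eq. intros eps Heps. rewrite Rminus_0_r.
  (* [Phi x] and the integral will both be at most e <= 1, so the total error is at most e * (2 + 2
     * Phi 0). *)
  set (e := Rmin 1 (eps / (2 * (2 + 2 * Phi 0)))).
  assert (He1 : e <= 1) by apply Rmin_l.
  assert (He2 : e * (2 + 2 * Phi 0) < eps).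
  { apply (Rle_lt_trans _ (eps / (2 * (2 + 2 * Phi 0)) * (2 + 2 * Phi 0))).
    - apply Rmult_le_compat_r; [lra|apply Rmin_r].
    - replace (eps / (2 * (2 + 2 * Phi 0)) * (2 + 2 * Phi 0)) with (eps / 2) by (field; lra). lra. }
  assert (He0 : 0 < e) by (apply Rmin_glb_lt; [lra|apply Rdiv_lt_0_compat; lra]).
  destruct (proj2 hPhi e He0) as [M HM].
  (* x <= - 2 / e gives exp (- x^2 / 2) <= 1 / (1 + x^2 / 2) <= e. *)
  set (x := Rmin (M - 1) (- (2 / e))).
  assert (Hx1 : x < M) by (generalize (Rmin_l (M - 1) (- (2 / e))); unfold x; lra).
  assert (Hx2 : x <= - (2 / e)) by apply Rmin_r.
  assert (H2e : 2 <= 2 / e).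
  { apply (Rmult_le_reg_r e); [exact He0|]. unfold Rdiv. rewrite Rmult_assoc, Rinv_l; lra. }
  specialize (HM x Hx1).
  assert (Hk : RInt (gk x) 0 1 <= e).
  { eapply Rle_trans; [apply gk_RInt_bounds|]. rewrite exp_Ropp.
    rewrite <- (Rinv_inv e). apply Rinv_le_contravar; [apply Rinv_0_lt_compat; exact He0|].
    apply (Rle_trans _ (1 + x ^ 2 / 2)); [|apply exp_ineq1_le].
    unfold Rdiv in *. set (ie := / e) in *. nra. }
  generalize (Phi_gk_const x) (proj1 (gk_RInt_bounds x)); intros E Hk0.
  assert (E2 : Phi 0 ^ 2 - / 4 = - (Phi x ^ 2) + 2 * Phi x * Phi 0 - RInt (gk x) 0 1 / PI).
  { apply (Rmult_eq_reg_l PI); [|lra]. field_simplify; [|lra]. nra. }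
  rewrite E2.
  assert (Hkp : 0 <= RInt (gk x) 0 1 / PI <= e).
  { split; [apply Rdiv_le_0_compat; lra|]. apply (Rmult_le_reg_r PI); [lra|].
    unfold Rdiv. rewrite Rmult_assoc, Rinv_l by lra. nra. }
  generalize (Phi_nonneg x); intros Hx0. rewrite Rabs_pos_eq in HM by exact Hx0.
  apply Rabs_def1; nra. }
assert ((Phi 0 - / 2) * (Phi 0 + / 2) = 0) by nra.
apply Rmult_integral in H. destruct H; lra.
Qed.

(** The sum Phi (- y) + Phi y has derivative zero because the density is even, and its value 1 comes
    from [Phi_0]. This is how total mass one enters the Stein equation. *)
Lemma Phi_opp x : Phi (- x) = 1 - Phi x.
Proof.
assert (D : forall y, derivable_pt_lim (fun y => Phi (- y) + Phi y) y 0).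
{ intros y. apply (derivable_pt_lim_eq _ _ (- npdf (- y) + npdf y)); [|rewrite npdf_opp; ring].
  apply is_derive_Reals. apply (is_derive_plus (fun y => Phi (- y)) Phi); [|apply Phi_derive].
  generalize (Phi_derive (- y)); intros Hd.
  auto_derive; [exists (npdf (- y)); exact Hd|].
  replace (Derive (fun x => Phi x) (- y)) with (npdf (- y)) by (symmetry; apply is_derive_unique; exact Hd). ring. }
assert (C : forall a b, a < b -> Phi (- a) + Phi a = Phi (- b) + Phi b).
{ intros a b Hab.
  destruct (MVT_cor2 (fun y => Phi (- y) + Phi y) (fun _ => 0) a b Hab) as [c [E _]]; [intros; apply D|lra]. }
assert (E0 : Phi (- 0) + Phi 0 = 1) by (rewrite Ropp_0, Phi_0; lra).
destruct (Rtotal_order x 0) as [H|[->|H]].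
- generalize (C x 0 H). lra.
- lra.
- generalize (C 0 x H). lra.
Qed.

End GaussianIntegral.

(** * Stein equation of the normal distribution *)

Section SteinEquation.

Variable Phi : R -> R.
Hypothesis hPhi : is_std_normal_cdf Phi.

Lemma Phi_le_1 x : 0 <= Phi x <= 1.
Proof.
generalize (Phi_nonneg Phi hPhi x), (Phi_nonneg Phi hPhi (- x)).
rewrite (Phi_opp Phi hPhi). lra.
Qed.

(** The Mills ratio of the left tail. The Stein solution is a multiple of it to the left of z and a
    multiple of its reflection to the right. *)
Definition mills (w : R) : R := Phi w / npdf w.

Lemma npdf_derivable w : derivable_pt_lim npdf w (- w * npdf w).
Proof. apply is_derive_Reals, npdf_derive. Qed.

Lemma mills_derivable w : derivable_pt_lim mills w (1 + w * mills w).
Proof.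
generalize (npdf_pos w); intros Hp.
apply (derivable_pt_lim_eq _ _ ((npdf w * npdf w - (- w * npdf w) * Phi w) / (npdf w)²)).
- apply (derivable_pt_lim_div Phi npdf); [apply (proj1 hPhi)|apply npdf_derivable|lra].
- unfold mills, Rsqr. field. lra.
Qed.

Lemma npdf_le_1 w : npdf w <= 1.
Proof.
unfold std_normal_density. apply (Rmult_le_reg_r (sqrt (2 * PI))); [apply sqrt_2PI_pos|].
unfold Rdiv at 1. rewrite Rmult_assoc, Rinv_l by (generalize sqrt_2PI_pos; lra).
apply (Rle_trans _ 1).
- rewrite Rmult_1_r, <- exp_0. destruct (Req_dec w 0) as [->|H].
  + right; f_equal; field.
  + left; apply exp_increasing. generalize (Rsqr_pos_lt w H). unfold Rsqr. nra.
- rewrite Rmult_1_l, <- sqrt_1. apply sqrt_le_1_alt. generalize PI2_1; lra.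
Qed.

Lemma le_of_forall_eps a : (forall eps, 0 < eps -> - eps <= a) -> 0 <= a.
Proof.
intros H. destruct (Rle_lt_dec 0 a) as [Ha|Ha]; [exact Ha|].
specialize (H (- a / 2) ltac:(lra)). lra.
Qed.

(* [Phi w + w * npdf w / (1 + w^2)] is increasing and vanishes at minus infinity. *)
Lemma mills_lower w : 0 <= (1 + w ^ 2) * mills w + w.
Proof.
set (q := fun w => Phi w + (w * / (1 + w ^ 2)) * npdf w).
assert (P2 : forall x : R, 0 < 1 + x ^ 2) by (intros; generalize (pow2_ge_0 x); lra).
assert (Hq : forall x, derivable_pt_lim q x (2 * npdf x / (1 + x ^ 2) ^ 2)).
{ intros x. unfold q. generalize (P2 x); intros Hx.
  apply (derivable_pt_lim_eq _ _ (npdf x + ((1 - x ^ 2) / (1 + x ^ 2) ^ 2 * npdf x + (x * / (1 + x ^ 2)) * (- x * npdf x)))).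
  - apply (derivable_pt_lim_plus Phi); [apply (proj1 hPhi)|].
    apply (derivable_pt_lim_mult (fun x => x * / (1 + x ^ 2)) npdf); [|apply npdf_derivable].
    apply is_derive_Reals.
    auto_derive; [simpl in Hx; lra|]. simpl; field. simpl in Hx; lra.
  - field. lra. }
assert (H : 0 <= q w).
{ apply le_of_forall_eps. intros eps He.
  set (x := Rmin w (- / eps)).
  assert (Hx : x <= - / eps) by apply Rmin_r.
  assert (Hie : 0 < / eps) by (apply Rinv_0_lt_compat; exact He).
  apply (Rle_trans _ (q x)).
  - unfold q. generalize (proj1 (Phi_le_1 x)); intros Hphi.
    assert (B : - eps <= x * / (1 + x ^ 2)).
    { apply (Rmult_le_reg_r (1 + x ^ 2)); [apply P2|].
      rewrite Rmult_assoc, Rinv_l, Rmult_1_r by (generalize (P2 x); lra).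
      assert (1 <= eps * - x).
      { rewrite <- (Rinv_r eps) by lra. apply Rmult_le_compat_l; lra. }
      nra. }
    assert (x * / (1 + x ^ 2) <= 0).
    { apply (Rmult_le_reg_r (1 + x ^ 2)); [apply P2|].
      rewrite Rmult_assoc, Rinv_l, Rmult_1_r, Rmult_0_l by (generalize (P2 x); lra). lra. }
    generalize (npdf_le_1 x), (npdf_pos x); intros. nra.
  - apply (derivable_increasing_le q (fun x => 2 * npdf x / (1 + x ^ 2) ^ 2)); [apply Rmin_l|intros; apply Hq|].
    intros y _. generalize (npdf_pos y), (P2 y); intros.
    apply Rlt_le, Rdiv_lt_0_compat; [lra|apply pow_lt; assumption]. }
unfold q in H. generalize (npdf_pos w), (P2 w); intros Hp Hw.
replace ((1 + w ^ 2) * mills w + w) with ((1 + w ^ 2) * / npdf w * (Phi w + w * / (1 + w ^ 2) * npdf w)).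
- apply Rmult_le_pos; [|exact H]. apply Rmult_le_pos; [lra|left; apply Rinv_0_lt_compat; exact Hp].
- unfold mills. field. split; lra.
Qed.

Definition wmills (w : R) : R := w * mills w.

Lemma wmills_increasing x y : x <= y -> wmills x <= wmills y.
Proof.
intros H. apply (derivable_increasing_le wmills (fun w => (1 + w ^ 2) * mills w + w)); [exact H| |].
- intros w _. apply (derivable_pt_lim_eq _ _ (1 * mills w + w * (1 + w * mills w))); [|ring].
  apply (derivable_pt_lim_mult id mills); [apply derivable_pt_lim_id|apply mills_derivable].
- intros; apply mills_lower.
Qed.

(** For w < 0 this is the tail bound Phi w <= npdf w / (- w): the difference [r] of the two sides is
    increasing and tends to 0 at minus infinity. Monotonicity of [wmills] gives the rest. *)
Lemma wmills_ge w : -1 <= wmills w.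
Proof.
assert (N : forall w, w < 0 -> -1 <= wmills w).
{ clear w; intros w Hw.
  set (r := fun w => - / w * npdf w - Phi w).
  assert (Hr : forall x, x < 0 -> derivable_pt_lim r x (/ x ^ 2 * npdf x)).
  { intros x Hx. unfold r.
    apply (derivable_pt_lim_eq _ _ ((/ x ^ 2 * npdf x + - / x * (- x * npdf x)) - npdf x)); [|field; lra].
    apply (derivable_pt_lim_minus (fun w => - / w * npdf w)); [|apply (proj1 hPhi)].
    apply (derivable_pt_lim_mult (fun w => - / w) npdf); [|apply npdf_derivable].
    apply is_derive_Reals.
    auto_derive; [lra|]. field; lra. }
  assert (H : 0 <= r w).
  { apply le_of_forall_eps. intros eps He.
    destruct (proj2 hPhi eps He) as [M HM].
    set (x := Rmin w (M - 1)).
    assert (Hx : x < 0) by (generalize (Rmin_l w (M - 1)); unfold x; lra).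
    assert (Hx2 : x < M) by (generalize (Rmin_r w (M - 1)); unfold x; lra).
    specialize (HM x Hx2). rewrite Rabs_pos_eq in HM by apply Phi_le_1.
    apply (Rle_trans _ (r x)).
    - unfold r. assert (0 < - / x) by (generalize (Rinv_lt_0_compat x Hx); lra).
      generalize (npdf_pos x); nra.
    - apply (derivable_increasing_le r (fun x => / x ^ 2 * npdf x)); [apply Rmin_l| |].
      + intros y Hy; apply Hr; lra.
      + intros y Hy. apply Rmult_le_pos; [left; apply Rinv_0_lt_compat; nra|left; apply npdf_pos]. }
  unfold r in H. unfold wmills, mills.
  generalize (npdf_pos w); intros Hp.
  apply Ropp_le_cancel. replace (- -1) with 1 by ring.
  apply (Rmult_le_reg_r (- / w * npdf w)).
  { apply Rmult_lt_0_compat; [generalize (Rinv_lt_0_compat w Hw); lra|exact Hp]. }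
  replace (- (w * (Phi w / npdf w)) * (- / w * npdf w)) with (Phi w) by (field; lra). lra. }
destruct (Rlt_le_dec w 0) as [H|H]; [apply N; exact H|].
apply (Rle_trans _ (wmills (-1))); [apply N; lra|apply wmills_increasing; lra].
Qed.

Lemma mills_opp w : mills (- w) = (1 - Phi w) / npdf w.
Proof. unfold mills. rewrite (Phi_opp Phi hPhi), npdf_opp. reflexivity. Qed.

Variable z : R.

(* The bounded solution of [f' w - w * f w = 1_(w <= z) - Phi z]. *)
Definition stein_f (w : R) : R :=
  if Rle_dec w z then (1 - Phi z) * mills w else Phi z * mills (- w).

Definition stein_g (w : R) : R := w * stein_f w.

(* The nonsmooth part of [stein_f] is removed, so that the derivative is the increasing function [stein_g]. *)
Definition stein_smooth (w : R) : R := stein_f w - Rmin w z + Phi z * w.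

Lemma stein_g_left w : w <= z -> stein_g w = (1 - Phi z) * wmills w.
Proof. intros H. unfold stein_g, stein_f, wmills. destruct (Rle_dec w z); [ring|lra]. Qed.

Lemma stein_f_right w : z <= w -> stein_f w = Phi z * mills (- w).
Proof.
intros H. unfold stein_f. destruct (Rle_dec w z) as [H'|H']; [|reflexivity].
replace w with z by lra. rewrite mills_opp. unfold mills. field.
generalize (npdf_pos z); lra.
Qed.

Lemma stein_g_right w : z <= w -> stein_g w = - (Phi z * wmills (- w)).
Proof. intros H. unfold stein_g, wmills. rewrite stein_f_right by exact H. ring. Qed.

Lemma stein_g_increasing x y : x <= y -> stein_g x <= stein_g y.
Proof.
generalize (Phi_le_1 z); intros Hz.
assert (L : forall x y, x <= y -> y <= z -> stein_g x <= stein_g y).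
{ intros a b Hab Hb. rewrite !stein_g_left by lra. generalize (wmills_increasing a b Hab). nra. }
assert (G : forall x y, z <= x -> x <= y -> stein_g x <= stein_g y).
{ intros a b Ha Hab. rewrite !stein_g_right by lra. generalize (wmills_increasing (- b) (- a) ltac:(lra)). nra. }
intros H. destruct (Rle_lt_dec y z) as [Hy|Hy]; [apply L; lra|].
destruct (Rle_lt_dec x z) as [Hx|Hx]; [|apply G; lra].
apply (Rle_trans _ (stein_g z)); [apply L; lra|apply G; lra].
Qed.

Lemma stein_g_bound w : -1 <= stein_g w <= 1.
Proof.
generalize (Phi_le_1 z); intros Hz. split.
- apply (Rle_trans _ (stein_g (Rmin w z))); [|apply stein_g_increasing, Rmin_l].
  rewrite stein_g_left by apply Rmin_r. generalize (wmills_ge (Rmin w z)). nra.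
- apply (Rle_trans _ (stein_g (Rmax w z))); [apply stein_g_increasing, Rmax_l|].
  rewrite stein_g_right by apply Rmax_r. generalize (wmills_ge (- Rmax w z)). nra.
Qed.

(** Different formulas hold on the two sides of z, so the mean value theorem is applied on each
    side, with derivative [stein_g], and the pieces are added across z. *)
Lemma stein_smooth_increment x y : x <= y ->
  (y - x) * stein_g x <= stein_smooth y - stein_smooth x <= (y - x) * stein_g y.
Proof.
assert (L : forall x y, x <= y -> y <= z ->
  (y - x) * stein_g x <= stein_smooth y - stein_smooth x <= (y - x) * stein_g y).
{ intros a b Hab Hb. destruct Hab as [Hab| ->]; [|lra].
  destruct (MVT_cor2 (fun w => (1 - Phi z) * mills w + (Phi z - 1) * w) (fun w => (1 - Phi z) * wmills w) a b Hab)
    as [c [E Hc]].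
  { intros c _. apply (derivable_pt_lim_eq _ _ ((1 - Phi z) * (1 + c * mills c) + (Phi z - 1) * 1)).
    - apply (derivable_pt_lim_plus (fun w => (1 - Phi z) * mills w) (fun w => (Phi z - 1) * w)).
      + apply (derivable_pt_lim_scal mills), mills_derivable.
      + apply (derivable_pt_lim_scal id), derivable_pt_lim_id.
    - unfold wmills; ring. }
  assert (E2 : stein_smooth b - stein_smooth a = stein_g c * (b - a)).
  { rewrite stein_g_left by lra. rewrite <- E. unfold stein_smooth, stein_f.
    rewrite !Rmin_left by lra. destruct (Rle_dec a z), (Rle_dec b z); lra. }
  rewrite E2. generalize (stein_g_increasing a c ltac:(lra)), (stein_g_increasing c b ltac:(lra)). nra. }
assert (G : forall x y, z <= x -> x <= y ->
  (y - x) * stein_g x <= stein_smooth y - stein_smooth x <= (y - x) * stein_g y).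
{ intros a b Ha Hab. destruct Hab as [Hab| ->]; [|lra].
  destruct (MVT_cor2 (fun w => Phi z * mills (- w) + Phi z * w) (fun w => - (Phi z * wmills (- w))) a b Hab)
    as [c [E Hc]].
  { intros c _. apply (derivable_pt_lim_eq _ _ (Phi z * ((1 + - c * mills (- c)) * -1) + Phi z * 1)).
    - apply (derivable_pt_lim_plus (fun w => Phi z * mills (- w)) (fun w => Phi z * w)).
      + apply (derivable_pt_lim_scal (fun w => mills (- w))).
        apply (derivable_pt_lim_comp (fun w => - w) mills); [|apply mills_derivable].
        apply (derivable_pt_lim_opp id), derivable_pt_lim_id.
      + apply (derivable_pt_lim_scal id), derivable_pt_lim_id.
    - unfold wmills; ring. }
  assert (E2 : stein_smooth b - stein_smooth a = stein_g c * (b - a)).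
  { rewrite stein_g_right by lra. rewrite <- E. unfold stein_smooth.
    rewrite !stein_f_right, !Rmin_right by lra. lra. }
  rewrite E2. generalize (stein_g_increasing a c ltac:(lra)), (stein_g_increasing c b ltac:(lra)). nra. }
intros H. destruct (Rle_lt_dec y z) as [Hy|Hy]; [apply L; lra|].
destruct (Rle_lt_dec x z) as [Hx|Hx]; [|apply G; lra].
generalize (L x z Hx ltac:(lra)), (G z y ltac:(lra) ltac:(lra)),
  (stein_g_increasing x z Hx), (stein_g_increasing z y ltac:(lra)).
nra.
Qed.

(** Both orders of x and y occur, because a move can raise or lower W. The sandwich bounds the
    first-order error by (y - x) * (stein_g y - stein_g x), whose mean can be evaluated by
    exchangeability without any bound on y - x. *)
Lemma stein_smooth_convex x y :
  (y - x) * stein_g x <= stein_smooth y - stein_smooth x <= (y - x) * stein_g y.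
Proof.
destruct (Rle_lt_dec x y) as [H|H]; [apply stein_smooth_increment; exact H|].
generalize (stein_smooth_increment y x ltac:(lra)). lra.
Qed.

Definition below (w : R) : R := if Rle_dec w z then 1 else 0.

(** Companion for the nonsmooth part: [Rmin] is concave with slope [below], so the endpoints trade
    places. *)
Lemma Rmin_concave x y :
  (y - x) * below y <= Rmin y z - Rmin x z <= (y - x) * below x.
Proof.
unfold below, Rmin. destruct (Rle_dec x z), (Rle_dec y z); lra.
Qed.

End SteinEquation.

(** * Normal approximation by antisymmetry *)

Section SteinBound.

Variable m : nat.
Hypothesis hm : (2 <= m)%nat.

Definition moved (l l' : list nat) : Prop :=
  exists l1 a l2 k, l = l1 ++ a :: l2 /\ l' = l1 ++ k :: l2 /\ (k < m)%nat.

Lemma swapsum_le_moved l f g :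
  (forall l', moved l l' -> f l' <= g l') -> swapsum m l f <= swapsum m l g.
Proof.
revert f g; induction l as [|a l IH]; intros f g H; simpl; [lra|].
apply Rplus_le_compat.
- apply avg_le; [exact hm|]; intros k Hk. apply H. exists nil, a, l, k; auto.
- apply IH. intros l' (l1 & b & l2 & k & -> & -> & Hk). apply H.
  exists (a :: l1), b, l2, k; auto.
Qed.

Variable Phi : R -> R.
Hypothesis hPhi : is_std_normal_cdf Phi.

Variable n : nat.
Variables Y H : list nat -> R.
Hypothesis poisson : forall l, outcome m n l ->
  swapsum m l (fun l' => H l - H l') = Y l - Ex m n Y.
Variable B : R.
Hypothesis B_nonneg : 0 <= B.
Hypothesis H_bound : forall l l', outcome m n l -> moved l l' -> Rabs (H l - H l') <= B.
Hypothesis Y_var : 0 < Var m n Y.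

Definition swapYY (l : list nat) : R := swapsum m l (fun l' => (H l - H l') * (Y l - Y l')).
Definition swapY (l : list nat) : R := swapsum m l (fun l' => Y l - Y l').

(** Exchanging l and l' turns (H l - H l') q l into (H l' - H l) q l' without changing the mean; the
    right side averages these two equal expressions. *)
Lemma poisson_by_parts q :
  Ex m n (fun l => (Y l - Ex m n Y) * q l) =
  / 2 * Ex m n (fun l => swapsum m l (fun l' => (H l - H l') * (q l - q l'))).
Proof.
assert (E1 : Ex m n (fun l => (Y l - Ex m n Y) * q l) =
  Ex m n (fun l => swapsum m l (fun l' => (H l - H l') * q l))).
{ apply Ex_ext; [exact hm|]. intros l Hl. rewrite <- (poisson l Hl).
  rewrite Rmult_comm, <- swapsum_scal. apply (swapsum_ext m hm n); [exact Hl|]. intros; ring. }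
pose proof E1 as E2. rewrite (swapsum_exchangeable m hm n (fun l l' => (H l - H l') * q l)) in E2.
assert (E3 : Ex m n (fun l => swapsum m l (fun l' => (H l - H l') * (q l - q l')))
  = Ex m n (fun l => swapsum m l (fun l' => (H l - H l') * q l))
  + Ex m n (fun l => swapsum m l (fun l' => (H l' - H l) * q l'))).
{ rewrite <- Ex_plus. apply Ex_ext; [exact hm|]. intros l Hl.
  rewrite <- swapsum_plus. apply (swapsum_ext m hm n); [exact Hl|]. intros; ring. }
rewrite E3, <- E1, <- E2. lra.
Qed.

Lemma swapsum_antisym q :
  Ex m n (fun l => swapsum m l (fun l' => (Y l - Y l') * q l')) = - Ex m n (fun l => swapY l * q l).
Proof.
rewrite (swapsum_exchangeable m hm n (fun l l' => (Y l - Y l') * q l')).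
replace (- Ex m n (fun l => swapY l * q l)) with ((-1) * Ex m n (fun l => swapY l * q l)) by ring.
rewrite <- Ex_scal. apply Ex_ext; [exact hm|]. intros l Hl.
unfold swapY. rewrite (Rmult_comm _ (q l)), <- Rmult_assoc, <- swapsum_scal.
apply (swapsum_ext m hm n); [exact Hl|]. intros; ring.
Qed.

Lemma Ex_swapY : Ex m n swapY = 0.
Proof.
generalize (swapsum_antisym (fun _ => 1)). intros E.
rewrite (Ex_ext m hm n (fun l => swapsum m l (fun l' => (Y l - Y l') * 1)) swapY) in E.
- rewrite (Ex_ext m hm n (fun l => swapY l * 1) swapY) in E by (intros; ring). lra.
- intros l Hl. apply (swapsum_ext m hm n); [exact Hl|]. intros; ring.
Qed.

Lemma Ex_swapYY : Ex m n swapYY = 2 * Var m n Y.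
Proof.
assert (E : Ex m n (fun l => (Y l - Ex m n Y) * Y l) = Var m n Y).
{ rewrite Var_sq by exact hm. set (e := Ex m n Y).
  rewrite (Ex_ext m hm n _ (fun l => Y l ^ 2 - e * Y l)) by (intros; ring).
  rewrite Ex_minus, Ex_scal. fold e. ring. }
rewrite poisson_by_parts in E. rewrite <- E. unfold swapYY. lra.
Qed.

Let sg := sqrt (Var m n Y).
Let W l := (Y l - Ex m n Y) / sg.

Lemma sg_pos : 0 < sg.
Proof. apply sqrt_lt_R0; exact Y_var. Qed.

Lemma sg_sq : sg * sg = Var m n Y.
Proof. apply sqrt_sqrt; lra. Qed.

(** J below is known exactly from the Poisson equation, and approximately by replacing f (W l) - f
    (W l') with (W l - W l') f' (W l). After scaling by [sg], the error is at most B (Y l - Y l') (q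
    l - q l'), which sums to 2 B E[swapY q] in the mean. What remains is the fluctuation of [swapYY]
    about its mean, twice the variance, tested against the bounded f'. *)
Theorem stein_bound z :
  Rabs (Ex m n (fun l => below z (W l)) - Phi z)
  <= / Var m n Y * (sqrt (Var m n swapYY) + 2 * B * sqrt (Var m n swapY)).
Proof.
pose proof sg_pos as Hs. pose proof sg_sq as Hs2.
set (g := fun l => stein_g Phi z (W l)). set (b := fun l => below z (W l)).
set (fp := fun l => g l + b l - Phi z).
(* [g] is the slope of the convex part of f and [b] that of the concave part; the minus sign makes
   both first-order errors bounded by increments of [q]. *)
set (q := fun l => g l - b l).
pose proof (Phi_le_1 Phi hPhi z) as HPz.
assert (Hb : forall l, 0 <= b l <= 1) by (intros l; unfold b, below; destruct (Rle_dec _ _); lra).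
assert (Hg : forall l, -1 <= g l <= 1) by (intros l; apply stein_g_bound; exact hPhi).
assert (Hpt : forall l l', outcome m n l -> moved l l' ->
  Rabs (sg * ((H l - H l') * (stein_f Phi z (W l) - stein_f Phi z (W l')))
        - ((H l - H l') * (Y l - Y l')) * fp l) <= B * ((Y l - Y l') * q l - (Y l - Y l') * q l')).
{ intros l l' Hl Hll. specialize (H_bound l l' Hl Hll).
  generalize (stein_smooth_convex Phi hPhi z (W l') (W l)), (Rmin_concave z (W l') (W l)).
  assert (ED : sg * (W l - W l') = Y l - Y l') by (unfold W; field; lra).
  unfold stein_smooth. fold (g l) (g l') (b l) (b l').
  set (h := H l - H l') in *. set (D := Y l - Y l') in *.
  set (f1 := stein_f Phi z (W l)). set (f2 := stein_f Phi z (W l')).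
  set (r1 := Rmin (W l) z). set (r2 := Rmin (W l') z).
  intros [S1 S2] [R1 R2].
  set (X := f1 - r1 + Phi z * W l - (f2 - r2 + Phi z * W l')) in *.
  assert (S1' : D * g l' <= sg * X) by (rewrite <- ED; nra).
  assert (S2' : sg * X <= D * g l) by (rewrite <- ED; nra).
  assert (R1' : D * b l <= sg * (r1 - r2)) by (rewrite <- ED; nra).
  assert (R2' : sg * (r1 - r2) <= D * b l') by (rewrite <- ED; nra).
  set (A := (D * g l - sg * X) + (sg * (r1 - r2) - D * b l)).
  replace (sg * (h * (f1 - f2)) - h * D * fp l)
    with (h * ((sg * (r1 - r2) - D * b l) - (D * g l - sg * X))).
  2:{ unfold X, fp. rewrite <- ED. ring. }
  rewrite Rabs_mult.
  apply (Rle_trans _ (B * A)).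
  - apply Rmult_le_compat; [apply Rabs_pos|apply Rabs_pos|exact H_bound|].
    unfold A. apply Rabs_le. lra.
  - apply Rmult_le_compat_l; [generalize (Rabs_pos h); lra|]. unfold A, q. lra. }
(* [swapY] has mean zero, so its mean absolute value is at most its standard deviation, and |q| <=
   2. *)
assert (HLY : Ex m n (fun l => swapY l * q l) <= 2 * sqrt (Var m n swapY)).
{ eapply Rle_trans; [|apply Rmult_le_compat_l; [lra|apply (Ex_Rabs_le_sd m hm)]].
  rewrite <- Ex_scal. apply Ex_le; [exact hm|]. intros l _. rewrite Ex_swapY, Rminus_0_r.
  unfold q. specialize (Hg l). specialize (Hb l).
  unfold Rabs; destruct (Rcase_abs (swapY l)); nra. }
assert (HT : Ex m n (fun l => Rabs (2 * Var m n Y - swapYY l)) <= sqrt (Var m n swapYY)).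
{ eapply Rle_trans; [|apply (Ex_Rabs_le_sd m hm)]. rewrite Ex_swapYY.
  apply Ex_le; [exact hm|]. intros l _. rewrite Rabs_minus_sym. lra. }
set (J := Ex m n (fun l => sg * swapsum m l (fun l' => (H l - H l') * (stein_f Phi z (W l) - stein_f Phi z (W l'))))).
assert (EJ : J = 2 * Var m n Y * Ex m n g).
{ unfold J. rewrite Ex_scal.
  assert (E : Ex m n (fun l => (Y l - Ex m n Y) * stein_f Phi z (W l)) = sg * Ex m n g).
  { rewrite <- Ex_scal. apply Ex_ext; [exact hm|]. intros l _. unfold g, stein_g, W. field. lra. }
  rewrite (poisson_by_parts (fun l => stein_f Phi z (W l))) in E. rewrite <- Hs2. nra. }
assert (HJ : Rabs (J - Ex m n (fun l => swapYY l * fp l)) <= 2 * B * Ex m n (fun l => swapY l * q l)).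
{ unfold J. rewrite <- Ex_minus.
  eapply Rle_trans; [apply Ex_Rabs; exact hm|].
  apply (Rle_trans _ (Ex m n (fun l => B * (swapsum m l (fun l' => (Y l - Y l') * q l) - swapsum m l (fun l' => (Y l - Y l') * q l'))))).
  - apply Ex_le; [exact hm|]. intros l Hl.
    rewrite <- swapsum_minus, <- !swapsum_scal.
    unfold swapYY. rewrite (Rmult_comm _ (fp l)), <- swapsum_scal, <- swapsum_minus.
    apply Rabs_le. split.
    + match goal with |- - ?a <= ?b => replace (- a) with ((-1) * a) by ring end.
      rewrite <- swapsum_scal. apply swapsum_le_moved. intros l' Hll.
      generalize (Hpt l l' Hl Hll). unfold Rabs; destruct (Rcase_abs _); lra.
    + apply swapsum_le_moved. intros l' Hll.
      generalize (Hpt l l' Hl Hll). unfold Rabs; destruct (Rcase_abs _); lra.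
  - rewrite Ex_scal, Ex_minus, swapsum_antisym.
    rewrite (Ex_ext m hm n (fun l => swapsum m l (fun l' => (Y l - Y l') * q l)) (fun l => swapY l * q l)).
    + right; ring.
    + intros l Hl. unfold swapY. rewrite (Rmult_comm _ (q l)), <- swapsum_scal.
      apply (swapsum_ext m hm n); [exact Hl|]. intros; ring. }
assert (HM : Rabs (Ex m n (fun l => (2 * Var m n Y - swapYY l) * fp l)) <= 2 * sqrt (Var m n swapYY)).
{ eapply Rle_trans; [apply Ex_Rabs; exact hm|].
  eapply Rle_trans; [|apply Rmult_le_compat_l; [lra|exact HT]].
  rewrite <- Ex_scal. apply Ex_le; [exact hm|]. intros l _.
  rewrite Rabs_mult, (Rmult_comm 2 (Rabs _)). apply Rmult_le_compat_l; [apply Rabs_pos|].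
  unfold fp. specialize (Hg l). specialize (Hb l). apply Rabs_le. lra. }
(* Stein equation in the mean: P(W <= z) - Phi z = E[f'] - E[W f], where J is twice the variance
   times E[W f]. *)
assert (EE : 2 * Var m n Y * (Ex m n b - Phi z) =
  Ex m n (fun l => (2 * Var m n Y - swapYY l) * fp l) - (J - Ex m n (fun l => swapYY l * fp l))).
{ rewrite EJ.
  rewrite (Ex_ext m hm n (fun l => (2 * Var m n Y - swapYY l) * fp l)
    (fun l => 2 * Var m n Y * (g l + b l - Phi z) - swapYY l * fp l)) by (intros; unfold fp; ring).
  rewrite !Ex_minus, Ex_scal, Ex_minus, Ex_plus, Ex_const by exact hm. ring. }
assert (HBpos : B * Ex m n (fun l => swapY l * q l) <= B * (2 * sqrt (Var m n swapY))).
{ apply Rmult_le_compat_l; [exact B_nonneg|exact HLY]. }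
apply (Rmult_le_reg_l (2 * Var m n Y)); [lra|].
rewrite <- (Rabs_pos_eq (2 * Var m n Y)) at 1 by lra. rewrite <- Rabs_mult.
fold b. rewrite EE.
replace (2 * Var m n Y * (/ Var m n Y * (sqrt (Var m n swapYY) + 2 * B * sqrt (Var m n swapY))))
  with (2 * sqrt (Var m n swapYY) + 4 * B * sqrt (Var m n swapY)) by (field; lra).
unfold Rminus at 1. eapply Rle_trans; [apply Rabs_triang|]. rewrite Rabs_Ropp. lra.
Qed.

End SteinBound.

(** * Upper bounds on variances *)

Section LocalVariance.

Variable m : nat.
Hypothesis hm : (2 <= m)%nat.
Variable n : nat.
Variable d : nat.
Hypothesis hd : (2 <= d)%nat.
Hypothesis hn : (d <= n)%nat.

Notation pi := (pb m n).
Notation lam := (INR n / INR m).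
Notation dR := (INR d).
Notation D := (steinD m n d).
Notation e := (diff (indic d)).

Lemma lam_bounds : / INR m <= lam /\ 0 < lam /\ 2 <= dR.
Proof.
pose proof (mpos m hm). pose proof (le_INR 2 d hd) as Hx. simpl in Hx.
assert (Hn : 1 <= INR n) by (apply (le_INR 1); lia).
assert (Hi : 0 < / INR m) by (apply Rinv_0_lt_compat; lra).
unfold Rdiv. repeat split; [nra|nra|lra].
Qed.

Lemma pb_le_1 k : pi k <= 1.
Proof.
rewrite <- (pb_sum m hm n).
destruct (le_lt_dec k n) as [H|H].
- rewrite <- (lsum_seq_single pi (S n) k) by lia. apply lsum_le; intros j _.
  destruct (Nat.eqb j k); [lra|apply pb_nonneg, hm].
- rewrite pb_gt by assumption. apply lsum_nonneg; intros; apply pb_nonneg, hm.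
Qed.

Lemma pb_up k : INR (S k) * pi (S k) <= 2 * lam * pi k.
Proof.
pose proof (mpos m hm) as Hm. pose proof (pb_balance m hm n k) as E.
pose proof (pb_nonneg m hm n k) as Hk. pose proof (pb_nonneg m hm n (S k)) as HSk.
pose proof (pos_INR k). pose proof (pos_INR (S k)).
apply (Rmult_le_reg_l (INR m)); [lra|].
replace (INR m * (2 * lam * pi k)) with (2 * (INR n * pi k)) by (field; lra).
assert (0 <= INR (S k) * pi (S k)) by (apply Rmult_le_pos; assumption).
assert (INR k * pi k >= 0) by (apply Rle_ge, Rmult_le_pos; assumption).
nra.
Qed.

(** n <= d * (n - d + 1) because (d - 1) * (n - d) >= 0; the rest is [pb_balance] at d - 1. The
    factor n/m on the left is essential: when n is small compared with m, pi (d - 1) is much larger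
    than pi d. *)
Lemma pb_down : lam * pi (pred d) <= dR ^ 2 * pi d.
Proof.
pose proof (mpos m hm) as Hm. pose proof lam_bounds as [_ [_ Hx]].
pose proof (pb_balance m hm n (pred d)) as E.
replace (S (pred d)) with d in E by lia.
assert (Ed : INR (pred d) = dR - 1) by (destruct d; [lia|rewrite S_INR; simpl; ring]).
rewrite Ed in E.
pose proof (pb_nonneg m hm n (pred d)) as Hk. pose proof (pb_nonneg m hm n d) as HSk.
assert (Hnd : dR <= INR n) by (apply le_INR; exact hn).
apply (Rmult_le_reg_l (INR m)); [lra|].
replace (INR m * (lam * pi (pred d))) with (INR n * pi (pred d)) by (field; lra).
apply (Rle_trans _ (dR * ((INR n - (dR - 1)) * pi (pred d)))).
- rewrite <- Rmult_assoc. apply Rmult_le_compat_r; [exact Hk|]. nra.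
- rewrite E. nra.
Qed.

Lemma e_spec k : e k = (if Nat.eqb k (pred d) then 1 else 0) - (if Nat.eqb k d then 1 else 0).
Proof.
unfold diff, indic. destruct (Nat.eqb_spec (S k) d), (Nat.eqb_spec k (pred d)); try lia; reflexivity.
Qed.

Lemma e_pred : e (pred d) = 1.
Proof. rewrite e_spec, Nat.eqb_refl. destruct (Nat.eqb_spec (pred d) d); [lia|ring]. Qed.

Lemma e_d : e d = -1.
Proof. rewrite e_spec, Nat.eqb_refl. destruct (Nat.eqb_spec d (pred d)); [lia|ring]. Qed.

Lemma e_other k : k <> pred d -> k <> d -> e k = 0.
Proof.
intros H1 H2. rewrite e_spec.
destruct (Nat.eqb_spec k (pred d)), (Nat.eqb_spec k d); try lia; ring.
Qed.

Lemma e_bound k : Rabs (e k) <= 1.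
Proof.
rewrite e_spec. destruct (Nat.eqb_spec k (pred d)), (Nat.eqb_spec k d); try lia;
 apply Rabs_le; lra.
Qed.

Lemma EB_three v : (forall k, k <> pred d -> k <> d -> k <> S d -> v k = 0) ->
  EB m n v = pi (pred d) * v (pred d) + pi d * v d + pi (S d) * v (S d).
Proof.
intros H. rewrite <- !(EB_single m hm n). rewrite <- !EB_plus.
apply EB_ext; [exact hm|]; intros k _.
destruct (Nat.eqb_spec k (pred d)), (Nat.eqb_spec k d), (Nat.eqb_spec k (S d)); subst; try lia; try ring.
rewrite H by assumption; ring.
Qed.

Definition Kloc : R := 4 * ((dR + 2) * dR ^ 2 + (dR + 2) + 2 * (dR + 3)).

Notation scale := (INR m * pi d * (1 + lam) ^ 4).

Lemma scale_ge t : 0 <= t <= (1 + lam) ^ 4 -> INR m * pi d * t <= scale.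
Proof.
intros H. apply Rmult_le_compat_l; [|lra].
apply Rmult_le_pos; [apply pos_INR|apply pb_nonneg, hm].
Qed.

(** [pb_down] controls pi (d - 1) only after multiplication by n/m, which is why the value at d - 1
    must be of order n/m; [pb_up] controls pi (d + 1). The bounds [B1], [B2], [B3] at d - 1, d, d +
    1 give the three summands of [Kloc]. *)
Lemma Var_local v c :
  (forall k, k <> pred d -> k <> d -> k <> S d -> v k = 0) ->
  Rabs (v (pred d)) <= c * lam -> Rabs (v d) <= c * (1 + lam) -> Rabs (v (S d)) <= c * (1 + lam) ->
  Var m n (lin m v) <= Kloc * c ^ 2 * scale.
Proof.
intros H0 H1 H2 H3.
pose proof (mpos m hm) as Hm. pose proof lam_bounds as [_ [Hl Hx]].
pose proof pb_down as Q1. pose proof (pb_up d) as Q2.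
pose proof (pb_nonneg m hm n (pred d)) as P1. pose proof (pb_nonneg m hm n d) as P2.
pose proof (pb_nonneg m hm n (S d)) as P3.
eapply Rle_trans; [apply (Var_lin_le m hm n)|].
rewrite EB_three.
2:{ intros k N1 N2 N3. rewrite (H0 k N1 N2 N3). ring. }
assert (SQ : forall a b, Rabs a <= b -> a ^ 2 <= b ^ 2).
{ intros a b Hab. rewrite <- (pow2_abs a). generalize (Rabs_pos a); nra. }
apply SQ in H1, H2, H3.
assert (Ed : INR (pred d) = dR - 1) by (destruct d; [lia|rewrite S_INR; simpl; ring]).
rewrite Ed, S_INR in *. set (L := lam) in *.
unfold Kloc. set (p0 := pi (pred d)) in *. set (p := pi d) in *. set (p1 := pi (S d)) in *.
set (v0 := v (pred d)) in *. set (vd := v d) in *. set (v2 := v (S d)) in *.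
assert (B1 : p0 * ((dR - 1 + 2 * L) * v0 ^ 2) <= p * c ^ 2 * ((dR + 2) * dR ^ 2 * (1 + L) ^ 4)).
{ apply (Rle_trans _ (p0 * ((dR - 1 + 2 * L) * (c * L) ^ 2))).
  { apply Rmult_le_compat_l; [exact P1|]. apply Rmult_le_compat_l; [lra|exact H1]. }
  apply (Rle_trans _ ((dR ^ 2 * p) * ((dR - 1 + 2 * L) * L * c ^ 2))).
  { replace (p0 * ((dR - 1 + 2 * L) * (c * L) ^ 2)) with ((L * p0) * ((dR - 1 + 2 * L) * L * c ^ 2)) by ring.
    apply Rmult_le_compat_r; [|exact Q1].
    apply Rmult_le_pos; [apply Rmult_le_pos; lra|apply pow2_ge_0]. }
  replace (dR ^ 2 * p * ((dR - 1 + 2 * L) * L * c ^ 2)) with (p * c ^ 2 * (dR ^ 2 * ((dR - 1 + 2 * L) * L))) by ring.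
  apply Rmult_le_compat_l; [apply Rmult_le_pos; [exact P2|apply pow2_ge_0]|].
  replace ((dR + 2) * dR ^ 2 * (1 + L) ^ 4) with (dR ^ 2 * ((dR + 2) * (1 + L) ^ 4)) by ring.
  apply Rmult_le_compat_l; [apply pow2_ge_0|].
  apply (Rle_trans _ ((dR + 2) * ((1 + L) * (1 + L)))).
  - replace ((dR + 2) * ((1 + L) * (1 + L))) with (((dR + 2) * (1 + L)) * (1 + L)) by ring.
    apply Rmult_le_compat; try lra; nra.
  - apply Rmult_le_compat_l; [lra|].
    replace ((1 + L) ^ 4) with (((1 + L) * (1 + L)) * ((1 + L) * (1 + L))) by ring.
    assert (1 <= (1 + L) * (1 + L)) by nra. nra. }
assert (B2 : p * ((dR + 2 * L) * vd ^ 2) <= p * c ^ 2 * ((dR + 2) * (1 + L) ^ 4)).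
{ apply (Rle_trans _ (p * ((dR + 2 * L) * (c * (1 + L)) ^ 2))).
  { apply Rmult_le_compat_l; [exact P2|]. apply Rmult_le_compat_l; [lra|exact H2]. }
  replace (p * ((dR + 2 * L) * (c * (1 + L)) ^ 2)) with (p * c ^ 2 * ((dR + 2 * L) * (1 + L) ^ 2)) by ring.
  apply Rmult_le_compat_l; [apply Rmult_le_pos; [exact P2|apply pow2_ge_0]|].
  replace ((dR + 2) * (1 + L) ^ 4) with (((dR + 2) * (1 + L) ^ 2) * (1 + L) ^ 2) by ring.
  apply Rmult_le_compat_r; [apply pow2_ge_0|]. nra. }
assert (B3 : p1 * ((dR + 1 + 2 * L) * v2 ^ 2) <= p * c ^ 2 * (2 * (dR + 3) * (1 + L) ^ 4)).
{ apply (Rle_trans _ (p1 * ((dR + 1 + 2 * L) * (c * (1 + L)) ^ 2))).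
  { apply Rmult_le_compat_l; [exact P3|]. apply Rmult_le_compat_l; [lra|exact H3]. }
  apply (Rle_trans _ ((2 * L * p) * ((dR + 1 + 2 * L) * (c * (1 + L)) ^ 2))).
  { apply Rmult_le_compat_r; [apply Rmult_le_pos; [lra|apply pow2_ge_0]|]. nra. }
  replace (2 * L * p * ((dR + 1 + 2 * L) * (c * (1 + L)) ^ 2))
    with (p * c ^ 2 * (2 * (((dR + 1 + 2 * L) * L) * (1 + L) ^ 2))) by ring.
  apply Rmult_le_compat_l; [apply Rmult_le_pos; [exact P2|apply pow2_ge_0]|].
  replace (2 * (dR + 3) * (1 + L) ^ 4) with (2 * (((dR + 3) * (1 + L) * (1 + L)) * (1 + L) ^ 2)) by ring.
  apply Rmult_le_compat_l; [lra|]. apply Rmult_le_compat_r; [apply pow2_ge_0|].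
  apply Rmult_le_compat; try lra; nra. }
replace (4 * ((dR + 2) * dR ^ 2 + (dR + 2) + 2 * (dR + 3)) * c ^ 2 * (INR m * p * (1 + L) ^ 4))
  with (4 * INR m * (p * c ^ 2 * ((dR + 2) * dR ^ 2 * (1 + L) ^ 4) + p * c ^ 2 * ((dR + 2) * (1 + L) ^ 4)
   + p * c ^ 2 * (2 * (dR + 3) * (1 + L) ^ 4))) by ring.
apply Rmult_le_compat_l; [lra|]. lra.
Qed.

(** * Variances of the two statistics in the normal approximation bound *)

Definition Hsol : list nat -> R := lin m (steinPhi m n d).
Definition Yocc : list nat -> R := lin m (indic d).

Notation c0 := (10 * dR + 12).

Lemma Var_Yocc : Var m n Yocc <= Kloc * scale.
Proof.
pose proof lam_bounds as [_ [Hl Hx]].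
rewrite <- (Rmult_1_r Kloc). replace 1 with (1 ^ 2) at 1 by ring. apply Var_local.
- intros k _ H _. unfold indic. destruct (Nat.eqb_spec k d); [lia|reflexivity].
- unfold indic. destruct (Nat.eqb_spec (pred d) d); [lia|]. rewrite Rabs_R0; lra.
- unfold indic. rewrite Nat.eqb_refl, Rabs_R1; lra.
- unfold indic. destruct (Nat.eqb_spec (S d) d); [lia|]. rewrite Rabs_R0; lra.
Qed.

(** The statistic is linear by [swapsum_lin]. An urn with d - 1 balls contributes only by gaining a
    ball, at rate at most n/m, which is the smallness that [Var_local] demands. *)
Lemma Var_swapY : Var m n (swapY m Yocc) <= Kloc * c0 ^ 2 * scale.
Proof.
pose proof (mpos m hm) as Hm. pose proof lam_bounds as [_ [Hl Hx]].
assert (Hnd : dR <= INR n) by (apply le_INR; exact hn).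
assert (Hi : 0 < / INR m) by (apply Rinv_0_lt_compat; lra).
set (g := fun k => INR k * (INR m - 1) / INR m * e (pred k) - (INR n - INR k) / INR m * e k).
rewrite (Var_ext m hm n (swapY m Yocc) (lin m g)) by (intros l Hl'; apply (swapsum_lin m hm n); exact Hl').
assert (Ed : INR (pred d) = dR - 1) by (destruct d; [lia|rewrite S_INR; simpl; ring]).
assert (R1 : 0 <= (INR m - 1) / INR m <= 1).
{ unfold Rdiv. split; [apply Rmult_le_pos; lra|]. apply (Rmult_le_reg_r (INR m)); [lra|].
  rewrite Rmult_assoc, Rinv_l; lra. }
assert (R2 : forall y, 0 <= y <= INR n -> 0 <= (INR n - y) / INR m <= lam).
{ intros y Hy. unfold Rdiv. split; [apply Rmult_le_pos; lra|apply Rmult_le_compat_r; lra]. }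
apply Var_local; unfold g.
- intros k N1 N2 N3. destruct k as [|k].
  + rewrite (e_other 0) by lia. simpl INR. unfold Rdiv; ring.
  + simpl pred. rewrite (e_other k), (e_other (S k)) by lia. ring.
- rewrite (e_other (pred (pred d))), e_pred, Ed by lia.
  generalize (R2 (dR - 1) ltac:(lra)). intros. rewrite Rmult_0_r, Rmult_1_r. apply Rabs_le. nra.
- rewrite e_pred, e_d. generalize (R2 dR ltac:(lra)). intros. apply Rabs_le.
  replace (dR * (INR m - 1) / INR m) with (dR * ((INR m - 1) / INR m)) by (unfold Rdiv; ring). nra.
- simpl pred. rewrite e_d, (e_other (S d)), S_INR by lia. apply Rabs_le.
  replace ((dR + 1) * (INR m - 1) / INR m) with ((dR + 1) * ((INR m - 1) / INR m)) by (unfold Rdiv; ring). nra.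
Qed.

Lemma D_bound k : -2 <= D k <= 2.
Proof.
generalize (steinD_bound' m hm n d hd hn k). unfold Rabs; destruct (Rcase_abs _); lra.
Qed.

(** The part of T that is a single sum over urns: the diagonal products of D and e in the expansion
    of (D i - D k) (e i - e k), minus the contribution of throws that return the ball to its urn. *)
Definition vlin (k : nat) : R :=
  INR k * (D (pred k) * e (pred k)) + lam * (D k * e k)
  - / INR m * (INR k * ((D (pred k) - D k) * (e (pred k) - e k))).

Lemma Var_vlin : Var m n (lin m vlin) <= Kloc * c0 ^ 2 * scale.
Proof.
pose proof (mpos m hm) as Hm. pose proof lam_bounds as [Hml [Hl Hx]].
assert (Hi : 0 < / INR m <= / 2).
{ split; [apply Rinv_0_lt_compat; lra|apply Rinv_le_contravar; lra]. }
assert (Ed : INR (pred d) = dR - 1) by (destruct d; [lia|rewrite S_INR; simpl; ring]).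
apply Var_local; unfold vlin.
- intros k N1 N2 N3. destruct k as [|k].
  + rewrite (e_other 0) by lia. simpl INR. ring.
  + simpl pred. rewrite (e_other k), (e_other (S k)) by lia. ring.
- rewrite (e_other (pred (pred d))), e_pred, Ed by lia.
  generalize (D_bound (pred d)), (D_bound (pred (pred d))). intros A B. apply Rabs_le.
  set (a := D (pred d)) in *. set (b := D (pred (pred d))) in *.
  replace ((dR - 1) * (b * 0) + lam * (a * 1) - / INR m * ((dR - 1) * ((b - a) * (0 - 1))))
    with (lam * a + / INR m * ((dR - 1) * (b - a))) by ring.
  (* The required factor n/m comes from 1/m <= n/m. *)
  assert (T : forall t, -4 <= t <= 4 -> - (4 * dR * lam) <= / INR m * ((dR - 1) * t) <= 4 * dR * lam).
  { intros t Ht. assert (- (4 * dR) <= (dR - 1) * t <= 4 * dR) by nra.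
    set (s := (dR - 1) * t) in *. nra. }
  generalize (T (b - a) ltac:(lra)). nra.
- rewrite e_pred, e_d.
  generalize (D_bound d), (D_bound (pred d)). intros A B. apply Rabs_le.
  set (a := D d) in *. set (b := D (pred d)) in *.
  replace (dR * (b * 1) + lam * (a * -1) - / INR m * (dR * ((b - a) * (1 - -1))))
    with (dR * b - lam * a - 2 * (/ INR m * (dR * (b - a)))) by ring.
  assert (T : forall t, -4 <= t <= 4 -> - (2 * dR) <= / INR m * (dR * t) <= 2 * dR).
  { intros t Ht. assert (- (4 * dR) <= dR * t <= 4 * dR) by nra.
    set (s := dR * t) in *. nra. }
  generalize (T (b - a) ltac:(lra)). nra.
- simpl pred. rewrite e_d, (e_other (S d)), S_INR by lia.
  generalize (D_bound d), (D_bound (S d)). intros A B. apply Rabs_le.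
  set (a := D d) in *. set (b := D (S d)) in *.
  replace ((dR + 1) * (a * -1) + lam * (b * 0) - / INR m * ((dR + 1) * ((a - b) * (-1 - 0))))
    with (- (dR + 1) * a + / INR m * ((dR + 1) * (a - b))) by ring.
  assert (T : forall t, -4 <= t <= 4 -> - (2 * (dR + 1)) <= / INR m * ((dR + 1) * t) <= 2 * (dR + 1)).
  { intros t Ht. assert (- (4 * (dR + 1)) <= (dR + 1) * t <= 4 * (dR + 1)) by nra.
    set (s := (dR + 1) * t) in *. nra. }
  generalize (T (a - b) ltac:(lra)). nra.
Qed.

Definition agrad (k : nat) : R := INR k * e (pred k).

Lemma Var_agrad : Var m n (lin m agrad) <= Kloc * c0 ^ 2 * scale.
Proof.
pose proof lam_bounds as [Hml [Hl Hx]].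
apply Var_local; unfold agrad.
- intros k N1 N2 N3. destruct k as [|k]; [simpl INR; ring|].
  simpl pred. rewrite (e_other k) by lia. ring.
- rewrite (e_other (pred (pred d))), Rmult_0_r, Rabs_R0 by lia. nra.
- rewrite e_pred. apply Rabs_le. nra.
- simpl pred. rewrite e_d, S_INR by lia. apply Rabs_le. nra.
Qed.

Lemma Var_bounded_lin v b : (forall k, (k <= n)%nat -> Rabs (v k) <= b) ->
  Var m n (lin m v) <= 12 * INR m * lam * b ^ 2.
Proof.
intros H. pose proof (mpos m hm) as Hm. pose proof lam_bounds as [Hml [Hl Hx]].
eapply Rle_trans; [apply (Var_lin_le m hm n)|].
replace (12 * INR m * lam * b ^ 2) with (4 * INR m * (3 * lam * b ^ 2)) by ring.
apply Rmult_le_compat_l; [lra|].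
apply (Rle_trans _ (EB m n (fun k => b ^ 2 * (INR k + 2 * lam)))).
- apply EB_le; [exact hm|]. intros k Hk. rewrite Rmult_comm.
  apply Rmult_le_compat_r; [generalize (pos_INR k); lra|].
  rewrite <- (pow2_abs (v k)). specialize (H k Hk). generalize (Rabs_pos (v k)); nra.
- rewrite EB_scal, EB_plus, (EB_INR m hm), (EB_const m hm). lra.
Qed.

Definition prod_aD (l : list nat) : R := (/ INR m * lin m D l) * lin m agrad l.

(** The first factor is at most 2 and the second is local. The mean of the second is at most of
    order m * pi d * (1 + n/m); in its square one factor pi d is bounded by 1. *)
Lemma Var_prod_aD : Var m n prod_aD <= (8 * (Kloc * c0 ^ 2) + 96 * (dR + 2) ^ 2) * scale.
Proof.
pose proof (mpos m hm) as Hm. pose proof lam_bounds as [Hml [Hl Hx]].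
assert (Hi : 0 < / INR m) by (apply Rinv_0_lt_compat; lra).
eapply Rle_trans; [apply (Var_prod_le m hm n _ _ 2)|].
- intros l Hl'. rewrite Rabs_mult, (Rabs_pos_eq (/ INR m)) by lra.
  apply (Rle_trans _ (/ INR m * (INR m * 2))); [|right; field; lra].
  apply Rmult_le_compat_l; [lra|]. apply (lin_bound m n); [exact Hl'|].
  intros; apply (steinD_bound' m hm n d hd hn).
- rewrite (Var_scal m hm n (/ INR m)), (Ex_lin m hm).
  assert (E : EB m n agrad = dR * pi d - (dR + 1) * pi (S d)).
  { rewrite EB_three.
    - unfold agrad. simpl pred. rewrite e_pred, e_d, S_INR, (e_other (pred (pred d))) by lia. ring.
    - intros k N1 N2 N3. unfold agrad. destruct k as [|k]; [simpl INR; ring|].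
      simpl pred. rewrite (e_other k) by lia. ring. }
  rewrite E. pose proof Var_agrad as H1.
  assert (H2 : Var m n (lin m D) <= 12 * INR m * lam * 2 ^ 2).
  { apply Var_bounded_lin. intros; apply (steinD_bound' m hm n d hd hn). }
  pose proof (pb_up d) as Q. rewrite S_INR in Q.
  pose proof (pb_nonneg m hm n d) as P2. pose proof (pb_nonneg m hm n (S d)) as P3. pose proof (pb_le_1 d) as P4.
  set (p := pi d) in *. set (p1 := (dR + 1) * pi (S d)) in *.
  assert (P5 : 0 <= p1) by (unfold p1; apply Rmult_le_pos; lra).
  assert (B1 : (dR * p - p1) ^ 2 <= p * ((dR + 2) ^ 2 * (1 + lam) ^ 2)).
  { apply (Rle_trans _ ((p * ((dR + 2) * (1 + lam))) ^ 2)).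
    - assert (A1 : - (p * ((dR + 2) * (1 + lam))) <= dR * p - p1 <= p * ((dR + 2) * (1 + lam))).
      { assert (0 <= lam * p) by (apply Rmult_le_pos; lra). nra. }
      nra.
    - replace ((p * ((dR + 2) * (1 + lam))) ^ 2) with (p * (p * ((dR + 2) ^ 2 * (1 + lam) ^ 2))) by ring.
      apply Rmult_le_compat_l; [exact P2|].
      rewrite <- (Rmult_1_l ((dR + 2) ^ 2 * _)) at 2. apply Rmult_le_compat_r; [|exact P4].
      apply Rmult_le_pos; apply pow2_ge_0. }
  assert (B2 : 2 * (INR m * (dR * p - p1)) ^ 2 * ((/ INR m) ^ 2 * Var m n (lin m D))
     <= 96 * (dR + 2) ^ 2 * (INR m * p * (1 + lam) ^ 4)).
  { replace (2 * (INR m * (dR * p - p1)) ^ 2 * ((/ INR m) ^ 2 * Var m n (lin m D)))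
      with (2 * (dR * p - p1) ^ 2 * Var m n (lin m D)) by (field; lra).
    apply (Rle_trans _ (2 * (p * ((dR + 2) ^ 2 * (1 + lam) ^ 2)) * (12 * INR m * lam * 2 ^ 2))).
    - apply Rmult_le_compat; [generalize (pow2_ge_0 (dR * p - p1)); lra|apply Var_nonneg, hm|lra|exact H2].
    - replace (2 * (p * ((dR + 2) ^ 2 * (1 + lam) ^ 2)) * (12 * INR m * lam * 2 ^ 2))
        with (96 * (dR + 2) ^ 2 * (INR m * p * (lam * (1 + lam) ^ 2))) by ring.
      apply Rmult_le_compat_l; [generalize (pow2_ge_0 (dR + 2)); lra|].
      apply scale_ge. split; [apply Rmult_le_pos; [lra|apply pow2_ge_0]|].
      replace ((1 + lam) ^ 4) with ((1 + lam) ^ 2 * (1 + lam) ^ 2) by ring.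
      apply Rmult_le_compat_r; [apply pow2_ge_0|nra]. }
  nra.
Qed.

Definition prod_Ye (l : list nat) : R := / (INR m - 1) * ((Yocc l - INR m * pi d) * lin m e l).

(** The sum of the e (N_j) is at most m in absolute value, so Y - mu gets multiplied by at most m /
    (m - 1) <= 2. *)
Lemma Var_prod_Ye : Var m n prod_Ye <= 4 * Kloc * scale.
Proof.
pose proof (mpos m hm) as Hm.
eapply Rle_trans; [apply (Var_le_sq m hm n _ 0)|].
assert (E : Ex m n Yocc = INR m * pi d).
{ unfold Yocc. rewrite (Ex_lin m hm). f_equal. rewrite (EB_ext m hm n _ (fun k => if Nat.eqb k d then 1 else 0)).
  - rewrite (EB_single m hm n d (fun _ => 1)). ring.
  - reflexivity. }
apply (Rle_trans _ (4 * Var m n Yocc)); [|generalize Var_Yocc; lra].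
unfold Var. rewrite E, <- Ex_scal. apply Ex_le; [exact hm|]. intros l Hl.
rewrite Rminus_0_r. unfold prod_Ye.
assert (H : Rabs (lin m e l) <= INR m * 1) by (apply (lin_bound m n); [exact Hl|intros; apply e_bound]).
set (t := Yocc l - INR m * pi d).
replace ((/ (INR m - 1) * (t * lin m e l)) ^ 2) with ((/ (INR m - 1) * lin m e l) ^ 2 * t ^ 2) by ring.
apply Rmult_le_compat_r; [apply pow2_ge_0|].
rewrite <- (pow2_abs (_ * _)). replace 4 with (2 ^ 2) by ring.
assert (HI : 0 < / (INR m - 1)) by (apply Rinv_0_lt_compat; lra).
rewrite Rabs_mult, (Rabs_pos_eq (/ (INR m - 1))) by lra.
apply pow_incr. split; [apply Rmult_le_pos; [lra|apply Rabs_pos]|].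
apply (Rle_trans _ (/ (INR m - 1) * INR m)); [apply Rmult_le_compat_l; lra|].
generalize (m_ratio_bounds m hm). unfold Rdiv. lra.
Qed.

Definition bflux (k : nat) : R := (INR n - INR k) * D k.

Definition prod_be (l : list nat) : R := (/ (INR m * (INR m - 1)) * lin m bflux l) * lin m e l.

(** [e] has value 1 at d - 1, too large for [Var_local]. The other factor compensates: it is at most
    4 n/m, with variance at most of order (n/m)^3 / m, and these powers of n/m are absorbed by
    [pb_down] at each occurrence of pi (d - 1). *)
Lemma Var_prod_be : Var m n prod_be <= (128 * ((dR + 2) * dR ^ 2 + (dR + 2)) + 384 * (dR ^ 4 + 1)) * scale.
Proof.
pose proof (mpos m hm) as Hm. pose proof lam_bounds as [Hml [Hl Hx]].
pose proof pb_down as Q1.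
pose proof (pb_nonneg m hm n (pred d)) as P1. pose proof (pb_nonneg m hm n d) as P2. pose proof (pb_le_1 d) as P4.
pose proof (pos_INR n) as Hn0.
assert (HI : 0 < / (INR m * (INR m - 1))) by (apply Rinv_0_lt_compat; nra).
assert (HI2 : / (INR m - 1) <= 2 / INR m).
{ apply (Rmult_le_reg_l (INR m - 1)); [lra|]. rewrite Rinv_r by lra.
  apply (Rmult_le_reg_r (INR m)); [lra|].
  replace ((INR m - 1) * (2 / INR m) * INR m) with (2 * (INR m - 1)) by (field; lra). lra. }
assert (HI3 : 0 < / (INR m - 1)) by (apply Rinv_0_lt_compat; lra).
assert (Hb : forall k, (k <= n)%nat -> Rabs (bflux k) <= 2 * INR n).
{ intros k Hk. unfold bflux. apply le_INR in Hk. rewrite Rabs_mult, Rabs_pos_eq by lra.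
  generalize (steinD_bound' m hm n d hd hn k), (pos_INR k), (Rabs_pos (D k)). nra. }
eapply Rle_trans; [apply (Var_prod_le m hm n _ _ (4 * lam))|].
- intros l Hl'. rewrite Rabs_mult, (Rabs_pos_eq (/ _)) by lra.
  apply (Rle_trans _ (/ (INR m * (INR m - 1)) * (INR m * (2 * INR n)))).
  + apply Rmult_le_compat_l; [lra|]. apply (lin_bound m n); assumption.
  + replace (/ (INR m * (INR m - 1)) * (INR m * (2 * INR n))) with (2 * INR n * / (INR m - 1)) by (field; lra).
    replace (4 * lam) with (2 * INR n * (2 / INR m)) by (field; lra).
    apply Rmult_le_compat_l; lra.
- rewrite (Var_scal m hm n (/ (INR m * (INR m - 1)))), (Ex_lin m hm).
  assert (E : EB m n e = pi (pred d) - pi d).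
  { rewrite EB_three.
    - rewrite e_pred, e_d, (e_other (S d)) by lia. ring.
    - intros; apply e_other; assumption. }
  rewrite E.
  assert (H1 : Var m n (lin m e) <= 4 * INR m * (pi (pred d) * (dR + 2 * lam) + pi d * (dR + 2 * lam))).
  { eapply Rle_trans; [apply (Var_lin_le m hm n)|].
    apply Rmult_le_compat_l; [lra|].
    rewrite EB_three by (intros; rewrite e_other by assumption; ring).
    rewrite e_pred, e_d, (e_other (S d)) by lia.
    assert (Ed : INR (pred d) = dR - 1) by (destruct d; [lia|rewrite S_INR; simpl; ring]).
    rewrite Ed. nra. }
  pose proof (Var_bounded_lin bflux (2 * INR n) Hb) as H2.
  set (p0 := pi (pred d)) in *. set (p := pi d) in *. set (L := lam) in *.
  assert (B1 : 2 * (4 * L) ^ 2 * Var m n (lin m e) <= 128 * ((dR + 2) * dR ^ 2 + (dR + 2)) * (INR m * p * (1 + L) ^ 4)).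
  { apply (Rle_trans _ (2 * (4 * L) ^ 2 * (4 * INR m * (p0 * (dR + 2 * L) + p * (dR + 2 * L))))).
    { apply Rmult_le_compat_l; [generalize (pow2_ge_0 (4 * L)); lra|exact H1]. }
    replace (2 * (4 * L) ^ 2 * (4 * INR m * (p0 * (dR + 2 * L) + p * (dR + 2 * L))))
      with (128 * INR m * (((dR + 2 * L) * L) * (L * p0) + ((dR + 2 * L) * (L * L)) * p)) by ring.
    replace (128 * ((dR + 2) * dR ^ 2 + (dR + 2)) * (INR m * p * (1 + L) ^ 4))
      with (128 * INR m * (((dR + 2) * (1 + L) ^ 4) * (dR ^ 2 * p) + ((dR + 2) * (1 + L) ^ 4) * p)) by ring.
    apply Rmult_le_compat_l; [lra|].
    assert (A0 : dR + 2 * L <= (dR + 2) * (1 + L)) by nra.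
    assert (A3 : 0 <= L * L <= (1 + L) ^ 2) by nra.
    assert (A4 : 1 <= (1 + L) ^ 2) by nra.
    assert (A1 : (dR + 2 * L) * L <= (dR + 2) * (1 + L) ^ 4).
    { apply (Rle_trans _ (((dR + 2) * (1 + L)) * (1 + L))); [apply Rmult_le_compat; lra|].
      replace ((dR + 2) * (1 + L) * (1 + L)) with ((dR + 2) * ((1 + L) ^ 2 * 1)) by ring.
      replace ((1 + L) ^ 4) with ((1 + L) ^ 2 * (1 + L) ^ 2) by ring.
      apply Rmult_le_compat_l; [lra|]. apply Rmult_le_compat_l; lra. }
    assert (A2 : (dR + 2 * L) * (L * L) <= (dR + 2) * (1 + L) ^ 4).
    { apply (Rle_trans _ (((dR + 2) * (1 + L)) * (1 + L) ^ 2)); [apply Rmult_le_compat; lra|].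
      replace ((dR + 2) * (1 + L) * (1 + L) ^ 2) with ((dR + 2) * (1 + L) ^ 3 * 1) by ring.
      replace ((dR + 2) * (1 + L) ^ 4) with ((dR + 2) * (1 + L) ^ 3 * (1 + L)) by ring.
      apply Rmult_le_compat_l; [|lra]. apply Rmult_le_pos; [lra|apply pow_le; lra]. }
    apply Rplus_le_compat.
    - apply Rmult_le_compat; [nra|nra|exact A1|exact Q1].
    - apply Rmult_le_compat_r; [exact P2|exact A2]. }
  assert (B2 : 2 * (INR m * (p0 - p)) ^ 2 * ((/ (INR m * (INR m - 1))) ^ 2 * Var m n (lin m bflux))
     <= 384 * (dR ^ 4 + 1) * (INR m * p * (1 + L) ^ 4)).
  { replace (2 * (INR m * (p0 - p)) ^ 2 * ((/ (INR m * (INR m - 1))) ^ 2 * Var m n (lin m bflux)))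
      with (2 * (p0 - p) ^ 2 * ((/ (INR m - 1)) ^ 2 * Var m n (lin m bflux))) by (field; lra).
    apply (Rle_trans _ (2 * (p0 ^ 2 + p ^ 2) * (192 * INR m * L ^ 3))).
    - apply Rmult_le_compat.
      + generalize (pow2_ge_0 (p0 - p)); lra.
      + apply Rmult_le_pos; [apply pow2_ge_0|apply Var_nonneg, hm].
      + assert (0 <= p0 * p) by (apply Rmult_le_pos; assumption). nra.
      + apply (Rle_trans _ ((2 / INR m) ^ 2 * (12 * INR m * L * (2 * INR n) ^ 2))).
        * apply Rmult_le_compat; [apply pow2_ge_0|apply Var_nonneg, hm| |exact H2].
          apply pow_incr; lra.
        * right. unfold L. field. lra.
    - replace (2 * (p0 ^ 2 + p ^ 2) * (192 * INR m * L ^ 3))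
        with (384 * INR m * (L * (L * p0) ^ 2 + L ^ 3 * p ^ 2)) by ring.
      replace (384 * (dR ^ 4 + 1) * (INR m * p * (1 + L) ^ 4))
        with (384 * INR m * ((1 + L) ^ 4 * (dR ^ 4 * p) + (1 + L) ^ 4 * p)) by ring.
      apply Rmult_le_compat_l; [lra|].
      assert (Hp2 : p ^ 2 <= p) by nra.
      assert (A5 : (L * p0) ^ 2 <= dR ^ 4 * p).
      { apply (Rle_trans _ ((dR ^ 2 * p) ^ 2)).
        - apply pow_incr. split; [apply Rmult_le_pos; lra|exact Q1].
        - replace ((dR ^ 2 * p) ^ 2) with (dR ^ 4 * p ^ 2) by ring.
          apply Rmult_le_compat_l; [apply pow_le; lra|exact Hp2]. }
      assert (A6 : 1 <= (1 + L) ^ 3) by (apply pow_R1_Rle; lra).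
      assert (A7 : L ^ 3 <= (1 + L) ^ 3) by (apply pow_incr; lra).
      assert (A8 : 0 <= L ^ 3) by (apply pow_le; lra).
      replace ((1 + L) ^ 4) with ((1 + L) * (1 + L) ^ 3) by ring.
      apply Rplus_le_compat.
      + apply Rmult_le_compat; [lra|apply pow2_ge_0|nra|exact A5].
      + apply Rmult_le_compat; [exact A8|apply pow2_ge_0|nra|exact Hp2]. }
  lra.
Qed.

(* The product of sum_j N_j D(N_j - 1) and sum_j e(N_j) is too large to be bounded directly when n is much
   smaller than m; the Poisson equation turns the first factor into [lin m bflux + m * (Y - mu)], up to 1/(m-1). *)
Lemma swapYY_decomposition l : outcome m n l ->
  swapYY m Yocc Hsol l = (lin m vlin l + (-1) * prod_aD l) + ((-1) * prod_Ye l + (-1) * prod_be l).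
Proof.
intros Hl. pose proof (mpos m hm) as Hm. unfold swapYY.
rewrite (swapsum_pairs m hm n l _ (fun i k => (D i - D k) * (e i - e k)) Hl).
- rewrite (lsum_ext _ (fun j => INR m * (INR (cnt l j) * (D (pred (cnt l j)) * e (pred (cnt l j))))
     - lin m e l * (INR (cnt l j) * D (pred (cnt l j)))
     - lin m D l * (INR (cnt l j) * e (pred (cnt l j)))
     + lin m (fun k => D k * e k) l * INR (cnt l j))).
  2:{ intros j _. set (i := pred (cnt l j)).
    rewrite (lin_ext m n (fun k => (D i - D k) * (e i - e k))
      (fun k => (D i * e i + D k * e k) - (D i * e k + e i * D k)) l Hl) by (intros; ring).
    rewrite lin_minus, !lin_plus, !lin_scal, (lin_const m). ring. }
  rewrite lsum_plus, !lsum_minus, !lsum_scal.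
  change (lsum (fun j => INR (cnt l j)) (seq 0 m)) with (lin m INR l). rewrite (lin_INR m hm n l Hl).
  change (lsum (fun j => INR (cnt l j) * (D (pred (cnt l j)) * e (pred (cnt l j)))) (seq 0 m))
    with (lin m (fun k => INR k * (D (pred k) * e (pred k))) l).
  change (lsum (fun j => INR (cnt l j) * D (pred (cnt l j))) (seq 0 m))
    with (lin m (fun k => INR k * D (pred k)) l).
  change (lsum (fun j => INR (cnt l j) * e (pred (cnt l j))) (seq 0 m)) with (lin m agrad l).
  assert (E : (INR m - 1) * lin m (fun k => INR k * D (pred k)) l
     = lin m bflux l + INR m * (Yocc l - INR m * pi d)).
  { unfold Yocc. rewrite <- (lin_const m (pi d) l), <- lin_minus, <- !lin_scal, <- lin_plus.
    apply (lin_ext m n); [exact Hl|]. intros k Hk.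
    rewrite <- (steinD_eq m hm n d hd hn k Hk). unfold bflux. field. lra. }
  assert (E2 : lin m (fun k => INR k * D (pred k)) l
     = / (INR m - 1) * (lin m bflux l + INR m * (Yocc l - INR m * pi d))) by (rewrite <- E; field; lra).
  rewrite E2.
  unfold prod_aD, prod_Ye, prod_be. unfold vlin.
  rewrite lin_minus, lin_plus, (lin_scal m lam), (lin_scal m (/ INR m)).
  field. lra.
- intros; ring.
- intros l1 a l2 k -> Hk. unfold Hsol, Yocc.
  rewrite !(lin_insert m hm) by (exact Hk || (apply Hl; apply in_or_app; right; left; reflexivity)).
  rewrite !diff_steinPhi. ring.
Qed.

Definition Ktot : R :=
  4 * (Kloc * c0 ^ 2 + (8 * (Kloc * c0 ^ 2) + 96 * (dR + 2) ^ 2) + 4 * Kloc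
       + (128 * ((dR + 2) * dR ^ 2 + (dR + 2)) + 384 * (dR ^ 4 + 1))).

Lemma Var_swapYY : Var m n (swapYY m Yocc Hsol) <= Ktot * scale.
Proof.
rewrite (Var_ext m hm n _ _ swapYY_decomposition).
eapply Rle_trans; [apply (Var_plus_le m hm n)|].
generalize (Var_plus_le m hm n (lin m vlin) (fun l => (-1) * prod_aD l)),
  (Var_plus_le m hm n (fun l => (-1) * prod_Ye l) (fun l => (-1) * prod_be l)).
rewrite !(Var_scal m hm n (-1)).
generalize Var_vlin, Var_prod_aD, Var_prod_Ye, Var_prod_be. unfold Ktot. intros. lra.
Qed.

Lemma Hsol_bound l l' : outcome m n l -> moved m l l' -> Rabs (Hsol l - Hsol l') <= 4.
Proof.
intros Hl (l1 & a & l2 & k & -> & -> & Hk). unfold Hsol.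
rewrite !(lin_insert m hm) by (exact Hk || (apply Hl; apply in_or_app; right; left; reflexivity)).
rewrite !diff_steinPhi. generalize (D_bound (cnt (l1 ++ l2) a)), (D_bound (cnt (l1 ++ l2) k)).
intros. apply Rabs_le. lra.
Qed.

End LocalVariance.

(** * Lower bound on the variance of the occupancy count *)

(** The value 3/8 is the maximum of row s = 3, and each later row averages neighbouring entries of
    the previous one. *)
Lemma pb_half_le s k : (3 <= s)%nat -> pb 2 s k <= 3 / 8.
Proof.
intros H. revert k. induction H as [|s H IH]; intros k.
- destruct k as [|[|[|[|k]]]]; simpl; lra.
- change (pb 2 (S s) k) with ((1 - / INR 2) * pb 2 s k
    + / INR 2 * match k with O => 0 | S k' => pb 2 s k' end).
  replace (/ INR 2) with (/ 2) by (simpl; reflexivity).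
  specialize (IH k) as IH1. destruct k as [|k]; [lra|]. specialize (IH k). lra.
Qed.

(** d >= 2 excludes the weights 1 and 1/2 found at s <= 2 and d <= 1. Hence the conditional mean of
    a pair of urns is at most 3/4, strictly below 1. *)
Lemma pb_half_bound s d : (2 <= d)%nat -> 0 <= pb 2 s d <= 3 / 8.
Proof.
intros Hd. split; [apply pb_nonneg; lia|].
destruct (le_lt_dec 3 s) as [H|H]; [apply pb_half_le; exact H|].
destruct d as [|[|[|d]]]; try lia; destruct s as [|[|[|s]]]; try lia; simpl; lra.
Qed.

(* Law of total variance for the partition of the urns into the pairs {j, j + h}: given the number of balls in
   each pair, the pairs are independent and inside a pair every ball chooses its urn by a fair coin. *)
Section PairResampling.

Variable m : nat.
Hypothesis hm : (2 <= m)%nat.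

Definition half : nat := (m / 2)%nat.

Lemma half_spec : (2 * half <= m <= 2 * half + 1)%nat /\ (1 <= half)%nat.
Proof.
unfold half. pose proof (Nat.div_mod_eq m 2) as E. pose proof (Nat.mod_upper_bound m 2 ltac:(lia)). lia.
Qed.

(** An involution; for odd m the last urn is its own mate. *)
Definition mate (j : nat) : nat :=
  if Nat.ltb j half then (j + half)%nat else if Nat.ltb j (2 * half) then (j - half)%nat else j.

Lemma avg_mate f : avg m (fun j => f (mate j)) = avg m f.
Proof.
pose proof half_spec as [H1 H2].
unfold avg. f_equal.
replace m with (half + (half + (m - 2 * half)))%nat by lia.
rewrite !seq_app, !lsum_app, !Nat.add_0_l.
rewrite (lsum_ext _ (fun j => f (half + j)%nat) (seq 0 half)).
2:{ intros j Hj. apply in_seq in Hj. unfold mate. destruct (Nat.ltb_spec j half); [|lia]. f_equal; lia. }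
rewrite lsum_seq_shift.
rewrite (lsum_ext (fun j => f (mate j)) (fun j => f (j - half)%nat) (seq half half)).
2:{ intros j Hj. apply in_seq in Hj. unfold mate. destruct (Nat.ltb_spec j half); [lia|].
  destruct (Nat.ltb_spec j (2 * half)); [|lia]. reflexivity. }
rewrite <- (lsum_seq_shift (fun j => f (j - half)%nat)).
rewrite (lsum_ext (fun t => f (half + t - half)%nat) f (seq 0 half)).
2:{ intros j _. f_equal; lia. }
rewrite (lsum_ext (fun j => f (mate j)) f (seq (half + half) _)).
2:{ intros j Hj. apply in_seq in Hj. unfold mate. destruct (Nat.ltb_spec j half); [lia|].
  destruct (Nat.ltb_spec j (2 * half)); [lia|]. reflexivity. }
ring.
Qed.

(** One fair coin per ball decides whether it goes to the mate of its urn: this is the conditional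
    expectation given the pair of every ball. *)
Fixpoint resample (l : list nat) (f : list nat -> R) : R :=
  match l with
  | nil => f nil
  | a :: l' => (resample l' (fun l'' => f (a :: l'')) + resample l' (fun l'' => f (mate a :: l''))) / 2
  end.

Lemma resample_ext l f g : (forall l', f l' = g l') -> resample l f = resample l g.
Proof.
revert f g; induction l as [|a l IH]; intros f g H; simpl; [apply H|].
rewrite (IH _ (fun l'' => g (a :: l''))), (IH (fun l'' => f (mate a :: l'')) (fun l'' => g (mate a :: l''))); auto.
Qed.

Lemma resample_plus l f g : resample l (fun l' => f l' + g l') = resample l f + resample l g.
Proof.
revert f g; induction l as [|a l IH]; intros f g; simpl; [reflexivity|]. rewrite !IH. field.
Qed.

Lemma resample_scal l c f : resample l (fun l' => c * f l') = c * resample l f.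
Proof.
revert f; induction l as [|a l IH]; intros f; simpl; [reflexivity|]. rewrite !IH. field.
Qed.

Lemma resample_const l c : resample l (fun _ => c) = c.
Proof. induction l as [|a l IH]; simpl; [reflexivity|]. rewrite IH; field. Qed.

Lemma resample_le l f g : (forall l', f l' <= g l') -> resample l f <= resample l g.
Proof.
revert f g; induction l as [|a l IH]; intros f g H; simpl; [apply H|].
generalize (IH (fun l'' => f (a :: l'')) (fun l'' => g (a :: l'')) ltac:(intros; apply H)),
 (IH (fun l'' => f (mate a :: l'')) (fun l'' => g (mate a :: l'')) ltac:(intros; apply H)). lra.
Qed.

Lemma resample_lsum {A} l (f : A -> list nat -> R) s :
  resample l (fun l' => lsum (fun a => f a l') s) = lsum (fun a => resample l (f a)) s.
Proof.
induction s as [|a s IH]; simpl; [apply resample_const|]. rewrite resample_plus, IH. reflexivity.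
Qed.

(** Tower property: [mate] permutes the urns ([avg_mate]), so a resampled ball is again uniform. *)
Lemma Ex_resample n f : Ex m n (fun l => resample l f) = Ex m n f.
Proof.
revert f; induction n as [|n IH]; intros f; [rewrite !Ex_0; reflexivity|].
rewrite !(Ex_S m hm). simpl.
rewrite (Ex_ext m hm n _ (fun l => / 2 * avg m (fun j => resample l (fun l'' => f (j :: l'')))
   + / 2 * avg m (fun j => resample l (fun l'' => f (mate j :: l''))))).
2:{ intros l _. rewrite <- !avg_scal, <- avg_plus. apply avg_ext; [exact hm|]. intros; field. }
rewrite Ex_plus, !Ex_scal, !(Ex_avg m hm).
rewrite (avg_ext m hm _ (fun j => Ex m n (fun l => f (j :: l)))) by (intros; apply IH).
rewrite (avg_ext m hm (fun j => Ex m n (fun l => resample l (fun l'' => f (mate j :: l''))))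
  (fun j => Ex m n (fun l => f (mate j :: l)))) by (intros; apply (IH (fun l => f (mate j :: l)))).
rewrite (avg_mate (fun j => Ex m n (fun l => f (j :: l)))). field.
Qed.

(** Stands in for measurability with respect to the coins of the balls outside [P]. *)
Definition blind (f : list nat -> R) (P : nat -> Prop) : Prop :=
  forall l1 a l2, P a -> f (l1 ++ a :: l2) = f (l1 ++ mate a :: l2).

(** [f] and [g] depend on the coins of disjoint sets of balls. In the induction the coin of the head
    ball affects only one factor, so the other one can be taken out. *)
Lemma resample_indep l f g P : (forall a, P a \/ ~ P a) -> blind f P -> blind g (fun a => ~ P a) ->
  resample l (fun l' => f l' * g l') = resample l f * resample l g.
Proof.
intros HP. revert f g; induction l as [|a l IH]; intros f g Hf Hg; simpl; [reflexivity|].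
assert (B : forall (h : list nat -> R) Q b, blind h Q -> blind (fun l'' => h (b :: l'')) Q).
{ intros h Q b Hh l1 c l2 Hc. apply (Hh (b :: l1) c l2 Hc). }
rewrite (IH (fun l'' => f (a :: l'')) (fun l'' => g (a :: l''))) by (apply B; assumption).
rewrite (IH (fun l'' => f (mate a :: l'')) (fun l'' => g (mate a :: l''))) by (apply B; assumption).
destruct (HP a) as [Ha|Ha].
- rewrite (resample_ext l (fun l'' => f (mate a :: l'')) (fun l'' => f (a :: l''))).
  + field.
  + intros l''. symmetry. apply (Hf nil a l'' Ha).
- rewrite (resample_ext l (fun l'' => g (mate a :: l'')) (fun l'' => g (a :: l''))).
  + field.
  + intros l''. symmetry. apply (Hg nil a l'' Ha).
Qed.

Definition ccov (l : list nat) (f g : list nat -> R) : R :=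
  resample l (fun l' => f l' * g l') - resample l f * resample l g.

Lemma ccov_sum_l l {A} (f : A -> list nat -> R) g s :
  ccov l (fun l' => lsum (fun a => f a l') s) g = lsum (fun a => ccov l (f a) g) s.
Proof.
unfold ccov. rewrite resample_lsum, lsum_minus.
rewrite (lsum_ext (fun x => resample l (f x) * resample l g)
  (fun x => resample l g * resample l (f x))) by (intros; ring).
rewrite lsum_scal, <- (resample_lsum l (fun x l' => f x l' * g l')). f_equal; [|ring].
apply resample_ext; intros l'. rewrite (Rmult_comm (lsum _ s)), <- lsum_scal.
apply lsum_ext; intros; ring.
Qed.

Lemma ccov_sym l f g : ccov l f g = ccov l g f.
Proof.
unfold ccov. rewrite (resample_ext l _ (fun l' => g l' * f l')) by (intros; ring). ring.
Qed.

Lemma ccov_nonneg l f : 0 <= ccov l f f.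
Proof.
unfold ccov. set (c := resample l f).
assert (H : 0 <= resample l (fun l' => (f l' - c) ^ 2)).
{ rewrite <- (resample_const l 0). apply resample_le. intros; apply pow2_ge_0. }
rewrite (resample_ext l _ (fun l' => (f l' * f l' + (- 2 * c) * f l') + c ^ 2)) in H by (intros; ring).
rewrite !resample_plus, resample_scal, resample_const in H. fold c in H. lra.
Qed.

(** Mean of [F] at the numbers of heads and tails of s fair coins: the conditional law of the two
    counts in a pair holding s balls. *)
Fixpoint coins (s : nat) (F : nat -> nat -> R) : R :=
  match s with
  | O => F 0%nat 0%nat
  | S s' => (coins s' (fun a b => F (S a) b) + coins s' (fun a b => F a (S b))) / 2
  end.

Lemma coins_plus s F G : coins s (fun a b => F a b + G a b) = coins s F + coins s G.
Proof.
revert F G; induction s as [|s IH]; intros F G; simpl; [reflexivity|]. rewrite !IH. field.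
Qed.

Lemma coins_ext s F G : (forall a b, F a b = G a b) -> coins s F = coins s G.
Proof.
revert F G; induction s as [|s IH]; intros F G H; simpl; [apply H|].
rewrite (IH _ (fun a b => G (S a) b)), (IH (fun a b => F a (S b)) (fun a b => G a (S b))); auto.
Qed.

Lemma coins_zero s : coins s (fun _ _ => 0) = 0.
Proof. induction s as [|s IH]; simpl; [reflexivity|]. rewrite IH; field. Qed.

Lemma coins_swap s F : coins s (fun a b => F b a) = coins s F.
Proof.
revert F; induction s as [|s IH]; intros F; simpl; [reflexivity|].
rewrite (IH (fun a b => F a (S b))), (IH (fun a b => F (S a) b)). field.
Qed.

Lemma coins_indic s k : coins s (fun a _ => indic k a) = pb 2 s k.
Proof.
revert k; induction s as [|s IH]; intros k.
- destruct k; reflexivity.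
- change (pb 2 (S s) k) with ((1 - / INR 2) * pb 2 s k
    + / INR 2 * match k with O => 0 | S k' => pb 2 s k' end).
  replace (/ INR 2) with (/ 2) by (simpl; reflexivity).
  simpl coins. rewrite IH. destruct k as [|k].
  + rewrite (coins_ext s (fun a _ => indic 0 (S a)) (fun _ _ => 0)), coins_zero by reflexivity. field.
  + rewrite (coins_ext s (fun a _ => indic (S k) (S a)) (fun a _ => indic k a)), IH by reflexivity. field.
Qed.

Lemma resample_pair l u v F : mate u = v -> mate v = u -> u <> v ->
  (forall a, a <> u -> a <> v -> mate a <> u /\ mate a <> v) ->
  resample l (fun l' => F (cnt l' u) (cnt l' v)) = coins (cnt l u + cnt l v) F.
Proof.
intros Hu Hv Huv Ho. revert F; induction l as [|a l IH]; intros F; [reflexivity|].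
simpl. destruct (Nat.eq_dec a u) as [->|Nu].
- rewrite Hu. destruct (Nat.eq_dec u v); [lia|].
  destruct (Nat.eq_dec v v); [|lia]. destruct (Nat.eq_dec v u); [lia|].
  simpl. rewrite (IH (fun x y => F (S x) y)), (IH (fun x y => F x (S y))). reflexivity.
- destruct (Nat.eq_dec a v) as [->|Nv].
  + rewrite Hv. destruct (Nat.eq_dec u u); [|lia]. destruct (Nat.eq_dec u v); [lia|].
    rewrite <- plus_n_Sm. simpl. rewrite (IH (fun x y => F (S x) y)), (IH (fun x y => F x (S y))). field.
  + destruct (Ho a Nu Nv) as [H1 H2].
    destruct (Nat.eq_dec (mate a) u); [lia|]. destruct (Nat.eq_dec (mate a) v); [lia|].
    rewrite (IH F). field.
Qed.

Variable d : nat.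
Hypothesis hd : (2 <= d)%nat.

Definition pairY (j : nat) (l : list nat) : R := indic d (cnt l j) + indic d (cnt l (half + j)%nat).
Definition restY (l : list nat) : R :=
  lsum (fun j => indic d (cnt l j)) (seq (2 * half) (m - 2 * half)).

Lemma Ys_pairs l : Yocc m d l = lsum (fun j => pairY j l) (seq 0 half) + restY l.
Proof.
pose proof half_spec as [H1 H2].
unfold Yocc, lin, restY, pairY. rewrite lsum_plus.
replace m with (half + (half + (m - 2 * half)))%nat at 1 by lia.
rewrite !seq_app, !lsum_app, !Nat.add_0_l, <- (lsum_seq_shift _ half half).
replace (half + half)%nat with (2 * half)%nat by lia. ring.
Qed.

Lemma mate_pair j : (j < half)%nat ->
  mate j = (half + j)%nat /\ mate (half + j) = j /\
  (forall a, a <> j -> a <> (half + j)%nat -> mate a <> j /\ mate a <> (half + j)%nat).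
Proof.
intros H. unfold mate. split; [|split].
- destruct (Nat.ltb_spec j half); lia.
- destruct (Nat.ltb_spec (half + j) half); [lia|].
  destruct (Nat.ltb_spec (half + j) (2 * half)); lia.
- intros a H1 H2. destruct (Nat.ltb_spec a half); [lia|].
  destruct (Nat.ltb_spec a (2 * half)); lia.
Qed.

Lemma cnt_blind u l1 a l2 : a <> u -> mate a <> u -> cnt (l1 ++ a :: l2) u = cnt (l1 ++ mate a :: l2) u.
Proof.
intros H1 H2. rewrite !count_occ_app. simpl.
destruct (Nat.eq_dec a u); [lia|]. destruct (Nat.eq_dec (mate a) u); [lia|reflexivity].
Qed.

Lemma pairY_blind j : (j < half)%nat -> blind (pairY j) (fun a => a <> j /\ a <> (half + j)%nat).
Proof.
intros Hj l1 a l2 [H1 H2]. destruct (mate_pair j Hj) as [_ [_ Ho]]. destruct (Ho a H1 H2).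
unfold pairY. rewrite !(cnt_blind _ l1 a l2) by assumption. reflexivity.
Qed.

Lemma ccov_indep l j g : (j < half)%nat -> blind g (fun a => a = j \/ a = (half + j)%nat) ->
  ccov l (pairY j) g = 0.
Proof.
intros Hj Hg. unfold ccov.
rewrite (resample_indep l (pairY j) g (fun a => a <> j /\ a <> (half + j)%nat)); [ring| | |].
- intros a. lia.
- apply pairY_blind; exact Hj.
- intros l1 a l2 Ha. apply Hg. lia.
Qed.

Lemma ccov_pairs l i j : (i < half)%nat -> (j < half)%nat -> i <> j -> ccov l (pairY i) (pairY j) = 0.
Proof.
intros Hi Hj Hij. apply ccov_indep; [exact Hi|].
intros l1 a l2 Ha. apply (pairY_blind j Hj). lia.
Qed.

Lemma ccov_rest l j : (j < half)%nat -> ccov l (pairY j) restY = 0.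
Proof.
intros Hj. apply ccov_indep; [exact Hj|].
intros l1 a l2 Ha. unfold restY. apply lsum_ext. intros k Hk. apply in_seq in Hk.
destruct (mate_pair j Hj) as [E1 [E2 _]].
rewrite (cnt_blind k l1 a l2); [reflexivity|lia|]. destruct Ha as [->| ->]; rewrite ?E1, ?E2; lia.
Qed.

(** The count X of a pair is 0, 1 or 2, so X^2 >= X, and its conditional mean is at most 3/4; the
    conditional variance is thus at least E X (1 - E X) >= E X / 4. *)
Lemma ccov_pair_ge l j : (j < half)%nat -> / 4 * resample l (pairY j) <= ccov l (pairY j) (pairY j).
Proof.
intros Hj. destruct (mate_pair j Hj) as [E1 [E2 Ho]].
assert (E : resample l (pairY j) = 2 * pb 2 (cnt l j + cnt l (half + j)%nat)%nat d).
{ unfold pairY.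
  rewrite (resample_pair l j (half + j)%nat (fun a b => indic d a + indic d b) E1 E2 ltac:(lia) Ho).
  rewrite (coins_plus _ (fun a _ => indic d a) (fun _ b => indic d b)).
  rewrite (coins_swap _ (fun a _ => indic d a)), coins_indic. ring. }
assert (Q : resample l (pairY j) <= resample l (fun l' => pairY j l' * pairY j l')).
{ apply resample_le. intros l'. unfold pairY, indic.
  destruct (Nat.eqb _ d), (Nat.eqb _ d); lra. }
unfold ccov. generalize (pb_half_bound (cnt l j + cnt l (half + j)%nat)%nat d hd). nra.
Qed.

Lemma ccov_Ys_ge l : / 4 * lsum (fun j => resample l (pairY j)) (seq 0 half) <= ccov l (Yocc m d) (Yocc m d).
Proof.
set (T := fun l' => lsum (fun j => pairY j l') (seq 0 half)).
assert (E : ccov l (Yocc m d) (Yocc m d) = ccov l T T + 2 * ccov l T restY + ccov l restY restY).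
{ unfold ccov.
  rewrite (resample_ext l (fun l' => Yocc m d l' * Yocc m d l')
    (fun l' => (T l' * T l' + 2 * (T l' * restY l')) + restY l' * restY l')).
  2:{ intros l'. rewrite Ys_pairs. fold (T l'). ring. }
  rewrite (resample_ext l (Yocc m d) (fun l' => T l' + restY l')) by (intros; apply Ys_pairs).
  rewrite !resample_plus, resample_scal. ring. }
assert (E1 : ccov l T restY = 0).
{ unfold T. rewrite (ccov_sum_l l pairY). rewrite (lsum_ext _ (fun _ => 0)), lsum_const; [ring|].
  intros j Hj; apply in_seq in Hj. apply ccov_rest; lia. }
assert (E2 : ccov l T T = lsum (fun j => ccov l (pairY j) (pairY j)) (seq 0 half)).
{ unfold T at 1. rewrite (ccov_sum_l l pairY). apply lsum_ext. intros j Hj; apply in_seq in Hj.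
  rewrite ccov_sym. unfold T. rewrite (ccov_sum_l l pairY).
  rewrite <- (lsum_seq_single (fun i => ccov l (pairY i) (pairY j)) half j) by lia.
  apply lsum_ext. intros i Hi; apply in_seq in Hi.
  destruct (Nat.eqb_spec i j) as [->|Hne]; [reflexivity|]. apply ccov_pairs; lia. }
rewrite E, E1, E2, <- lsum_scal.
assert (lsum (fun j => / 4 * resample l (pairY j)) (seq 0 half) <= lsum (fun j => ccov l (pairY j) (pairY j)) (seq 0 half)).
{ apply lsum_le. intros j Hj; apply in_seq in Hj. apply ccov_pair_ge; lia. }
generalize (ccov_nonneg l restY). lra.
Qed.

Theorem Var_Yocc_ge n : / 6 * (INR m * pb m n d) <= Var m n (Yocc m d).
Proof.
pose proof half_spec as [H1 H2].
assert (V : Ex m n (fun l => ccov l (Yocc m d) (Yocc m d)) <= Var m n (Yocc m d)).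
{ rewrite (Var_sq m hm). unfold ccov. rewrite Ex_minus, (Ex_resample n (fun l => Yocc m d l * Yocc m d l)).
  generalize (Var_nonneg m hm n (fun l => resample l (Yocc m d))).
  rewrite (Var_sq m hm), (Ex_resample n (Yocc m d)).
  rewrite (Ex_ext m hm n (fun l => Yocc m d l ^ 2) (fun l => Yocc m d l * Yocc m d l)) by (intros; ring).
  rewrite (Ex_ext m hm n (fun l => resample l (Yocc m d) ^ 2) (fun l => resample l (Yocc m d) * resample l (Yocc m d)))
    by (intros; ring). lra. }
eapply Rle_trans; [|exact V].
eapply Rle_trans; [|apply Ex_le; [exact hm|intros l _; apply ccov_Ys_ge]].
rewrite Ex_scal, (Ex_lsum m hm n (fun j l => resample l (pairY j))).
rewrite (lsum_ext _ (fun _ => 2 * pb m n d)).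
- rewrite lsum_const, length_seq.
  pose proof (pb_nonneg m hm n d).
  (* m <= 2 * half + 1 <= 3 * half turns 1/4 * half * (2 * pi d) into the constant 1/6. *)
  assert (INR m <= 3 * INR half).
  { replace 3 with (INR 3) by (simpl; ring). rewrite <- mult_INR. apply le_INR. lia. }
  nra.
- intros j Hj. apply in_seq in Hj. rewrite Ex_resample. unfold pairY. rewrite Ex_plus.
  rewrite (Ex_cnt m hm n j (indic d)), (Ex_cnt m hm n (half + j)%nat (indic d)) by lia.
  assert (E : EB m n (indic d) = pb m n d).
  { rewrite <- (Rmult_1_r (pb m n d)). apply (EB_single m hm n d (fun _ => 1)). }
  rewrite E. ring.
Qed.

End PairResampling.

(** * Explicit mean and variance *)

Lemma C_n_0 n : C n 0 = 1.
Proof. unfold C. rewrite Nat.sub_0_r. simpl. field. apply INR_fact_neq_0. Qed.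

Lemma C_n_n n : C n n = 1.
Proof. unfold C. rewrite Nat.sub_diag. simpl. field. apply INR_fact_neq_0. Qed.

Section Moments.

Variable m : nat.
Hypothesis hm : (2 <= m)%nat.

Lemma pb_closed n k : (k <= n)%nat -> pb m n k = C n k * (1 / INR m) ^ k * (1 - 1 / INR m) ^ (n - k).
Proof.
assert (E1 : 1 / INR m = / INR m) by (unfold Rdiv; ring). rewrite E1.
revert k; induction n as [|n IH]; intros k Hk.
- assert (k = 0)%nat by lia; subst k. rewrite C_n_0. simpl. ring.
- change (pb m (S n) k) with ((1 - / INR m) * pb m n k + / INR m * match k with O => 0 | S k' => pb m n k' end).
  destruct k as [|k].
  + rewrite IH by lia. rewrite !C_n_0, !Nat.sub_0_r. simpl. ring.
  + rewrite (IH k) by lia.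
    destruct (Nat.eq_dec k n) as [->|Hne].
    * rewrite (pb_gt m hm n (S n)) by lia. rewrite !C_n_n, !Nat.sub_diag. simpl. ring.
    * rewrite (IH (S k)) by lia. rewrite <- (pascal n k) by lia.
      replace (n - k)%nat with (S (n - S k)) by lia. replace (S n - S k)%nat with (S (n - S k)) by lia.
      simpl. ring.
Qed.

(** The trinomial law of the counts of two fixed urns, in the recursive form that matches [Ex_S]. *)
Fixpoint pb2 (n a b : nat) : R :=
  match n with
  | O => match a, b with O, O => 1 | _, _ => 0 end
  | S n' => (1 - 2 / INR m) * pb2 n' a b
     + / INR m * match a with O => 0 | S a' => pb2 n' a' b end
     + / INR m * match b with O => 0 | S b' => pb2 n' a b' end
  end.

Lemma pb2_gt n a b : (n < a + b)%nat -> pb2 n a b = 0.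
Proof.
revert a b; induction n as [|n IH]; intros a b H; simpl.
- destruct a, b; try lia; reflexivity.
- rewrite IH by lia.
  destruct a as [|a], b as [|b]; rewrite ?(IH a) by lia; rewrite ?IH by lia; try lia; ring.
Qed.

Lemma pb2_closed n a b c : (n = a + b + c)%nat ->
  pb2 n a b = INR (fact n) / (INR (fact a) * INR (fact b) * INR (fact c))
    * (1 / INR m) ^ (a + b) * (1 - 2 / INR m) ^ c.
Proof.
assert (E1 : 1 / INR m = / INR m) by (unfold Rdiv; ring). rewrite E1.
set (q := / INR m). set (y := 1 - 2 / INR m).
assert (F : forall k, INR (fact k) <> 0) by apply INR_fact_neq_0.
assert (S1 : forall k, INR (fact (S k)) = (INR k + 1) * INR (fact k)).
{ intros k. rewrite fact_simpl, mult_INR, S_INR. reflexivity. }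
assert (P1 : forall k, INR k + 1 <> 0) by (intros k; generalize (pos_INR k); lra).
revert a b c; induction n as [|n IH]; intros a b c H.
- assert (a = 0 /\ b = 0 /\ c = 0)%nat as (-> & -> & ->) by lia. simpl. field.
(* The terms of the recursion are c, a and b times the common factor fact n * G, also when a count
   is zero; they add up because a + b + c = n + 1. *)
- set (G := / (INR (fact a) * INR (fact b) * INR (fact c)) * q ^ (a + b) * y ^ c).
  assert (T0 : y * pb2 n a b = INR (fact n) * (INR c * G)).
  { destruct c as [|c].
    - rewrite pb2_gt by lia. simpl. ring.
    - rewrite (IH a b c) by lia. unfold G. rewrite S1, S_INR. simpl. field. auto. }
  assert (T1 : q * match a with O => 0 | S a' => pb2 n a' b end = INR (fact n) * (INR a * G)).
  { destruct a as [|a]; [simpl; ring|].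
    rewrite (IH a b c) by lia. unfold G. rewrite S1, S_INR. simpl Nat.add. simpl pow. field. auto. }
  assert (T2 : q * match b with O => 0 | S b' => pb2 n a b' end = INR (fact n) * (INR b * G)).
  { destruct b as [|b]; [simpl; ring|].
    rewrite (IH a b c) by lia. unfold G. rewrite S1, S_INR, <- plus_n_Sm. simpl pow. field. auto. }
  simpl pb2. fold q y. rewrite T0, T1, T2, S1.
  assert (EN : INR n + 1 = INR a + INR b + INR c) by (rewrite <- S_INR, H, !plus_INR; reflexivity).
  rewrite EN. unfold G. field. auto.
Qed.

Lemma Ex_cnt2 n i j a b : (i < m)%nat -> (j < m)%nat -> i <> j ->
  Ex m n (fun l => indic a (cnt l i) * indic b (cnt l j)) = pb2 n a b.
Proof.
intros Hi Hj Hij. pose proof (mpos m hm) as Hm.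
revert a b; induction n as [|n IH]; intros a b.
- rewrite Ex_0. destruct a, b; unfold indic; simpl; ring.
- rewrite (Ex_S m hm). simpl pb2.
  assert (Sh : forall c k, indic c (S k) = match c with O => 0 | S c' => indic c' k end).
  { intros [|c] k; reflexivity. }
  rewrite (Ex_ext m hm n _ (fun l => (1 - 2 / INR m) * (indic a (cnt l i) * indic b (cnt l j))
    + / INR m * (match a with O => 0 | S a' => indic a' (cnt l i) * indic b (cnt l j) end)
    + / INR m * (match b with O => 0 | S b' => indic a (cnt l i) * indic b' (cnt l j) end))).
  + rewrite !Ex_plus, !Ex_scal, IH. f_equal; [f_equal|].
    * f_equal. destruct a; [apply (Ex_const m hm)|apply IH].
    * f_equal. destruct b; [apply (Ex_const m hm)|apply IH].
  + intros l _. set (A := indic a (cnt l i)). set (B := indic b (cnt l j)).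
    unfold avg. rewrite (lsum_ext _ (fun k => A * B
      + (if Nat.eqb k i then (indic a (S (cnt l i)) - A) * B else 0)
      + (if Nat.eqb k j then A * (indic b (S (cnt l j)) - B) else 0))).
    * rewrite !lsum_plus, lsum_const, length_seq.
      rewrite (lsum_seq_single (fun _ => (indic a (S (cnt l i)) - A) * B)) by exact Hi.
      rewrite (lsum_seq_single (fun _ => A * (indic b (S (cnt l j)) - B))) by exact Hj.
      rewrite !Sh. unfold A, B. destruct a, b; field; lra.
    * intros k _. simpl. unfold A, B.
      destruct (Nat.eq_dec k i), (Nat.eqb_spec k i), (Nat.eq_dec k j), (Nat.eqb_spec k j); try lia; ring.
Qed.

Variables d n : nat.
Hypothesis hn : (d <= n)%nat.

Lemma Ex_Yocc : Ex m n (Yocc m d) = mu_nm d n m.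
Proof.
unfold Yocc. rewrite (Ex_lin m hm).
transitivity (INR m * pb m n d).
- f_equal. rewrite <- (Rmult_1_r (pb m n d)). apply (EB_single m hm n d (fun _ => 1)).
- rewrite pb_closed by exact hn. unfold mu_nm. ring.
Qed.

Lemma Ex_Yocc_sq : Ex m n (fun l => Yocc m d l ^ 2) =
  mu_nm d n m + INR m * (INR m - 1) * pb2 n d d.
Proof.
rewrite (Ex_ext m hm n _ (fun l => lsum (fun i => lsum (fun j => indic d (cnt l i) * indic d (cnt l j)) (seq 0 m)) (seq 0 m))).
2:{ intros l _. unfold Yocc, lin. set (u := fun j => indic d (cnt l j)).
  transitivity (lsum (fun i => lsum u (seq 0 m) * u i) (seq 0 m)); [rewrite lsum_scal; ring|].
  apply lsum_ext. intros i _. rewrite Rmult_comm. symmetry. apply (lsum_scal (u i) u). }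
rewrite (Ex_lsum m hm n (fun i l => lsum (fun j => indic d (cnt l i) * indic d (cnt l j)) (seq 0 m))).
rewrite <- Ex_Yocc. unfold Yocc, lin. rewrite (Ex_lsum m hm n (fun j l => indic d (cnt l j))).
transitivity (lsum (fun i => Ex m n (fun l => indic d (cnt l i)) + (INR m - 1) * pb2 n d d) (seq 0 m)).
- apply lsum_ext. intros i Hi. apply in_seq in Hi.
  rewrite (Ex_lsum m hm n (fun j l => indic d (cnt l i) * indic d (cnt l j))).
  rewrite (lsum_ext _ (fun j => pb2 n d d
    + (if Nat.eqb j i then Ex m n (fun l => indic d (cnt l i)) - pb2 n d d else 0))).
  + rewrite lsum_plus, lsum_const, length_seq.
    rewrite (lsum_seq_single (fun _ => Ex m n (fun l => indic d (cnt l i)) - pb2 n d d)) by lia. ring.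
  + intros j Hj. apply in_seq in Hj. destruct (Nat.eqb_spec j i) as [->|Hne].
    * rewrite Rplus_minus. apply Ex_ext; [exact hm|]. intros l _. unfold indic. destruct (Nat.eqb _ d); ring.
    * rewrite Ex_cnt2 by lia. ring.
- rewrite lsum_plus, lsum_const, length_seq. ring.
Qed.

Lemma Var_Yocc_sigma2 : Var m n (Yocc m d) = sigma2_nm d n m.
Proof.
rewrite (Var_sq m hm), Ex_Yocc, Ex_Yocc_sq. unfold sigma2_nm. f_equal. f_equal.
destruct (Nat.ltb_spec n (2 * d)) as [H|H].
(* With n < 2 d two urns cannot both hold d balls, in agreement with the zero convention of
   [sigma2_nm]. *)
- rewrite pb2_gt by lia. ring.
- rewrite (pb2_closed n d d (n - 2 * d)) by lia. replace (d + d)%nat with (2 * d)%nat by lia. ring.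
Qed.

Lemma probW_le_Ex z : probW_le d n m z =
  Ex m n (fun l => below z ((Yocc m d l - Ex m n (Yocc m d)) / sqrt (Var m n (Yocc m d)))).
Proof.
unfold probW_le. rewrite lsum_filter_length. unfold Ex at 1. unfold Rdiv at 1 2. f_equal.
apply lsum_ext. intros l _. rewrite Ex_Yocc, Var_Yocc_sigma2.
unfold W_nm, sigma_nm, below, occY. rewrite lsum_filter_length.
change (lsum (fun j => if Nat.eqb (cnt l j) d then 1 else 0) (seq 0 m)) with (Yocc m d l).
destruct (Rle_dec _ z); reflexivity.
Qed.

End Moments.

(** * Assembly of the bound *)

Lemma sqrt_le_of_sq x y : 0 <= y -> x <= y ^ 2 -> sqrt x <= y.
Proof.
intros Hy H. rewrite <- (sqrt_pow2 y Hy). apply sqrt_le_1_alt, H.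
Qed.

Theorem theorem1p1 (d : nat) (hd : (2 <= d)%nat) (Phi : R -> R)
  (hPhi : is_std_normal_cdf Phi) :
  exists Cst : R, forall (n m : nat), (d <= n)%nat -> (2 <= m)%nat ->
    forall z : R, Rabs (probW_le d n m z - Phi z) <= Cst / r_nm d n m.
Proof.
set (K1 := sqrt (6 * Ktot d)).
set (K2 := sqrt (6 * (Kloc d * (10 * INR d + 12) ^ 2))).
(* The 6 in [K1] and [K2] comes from the lower bound mu / 6 on the variance, 8 is 2 * B with B = 4
   from [Hsol_bound], and the outer 4 is that of (1 + L)^2 <= 4 * (1 + L^3). *)
exists (4 * (K1 + 8 * K2)). intros n m hn hm z.
pose proof (mpos m hm) as Hm. destruct (lam_bounds m hm n d hd hn) as [_ [Hl Hx]].
assert (Hp : 0 < INR m * pb m n d).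
{ apply Rmult_lt_0_compat; [lra|apply pb_pos; assumption]. }
pose proof (Var_Yocc_ge m hm d hd n) as Hlow.
assert (Hv : 0 < Var m n (Yocc m d)) by lra.
rewrite probW_le_Ex by assumption.
eapply Rle_trans; [apply (stein_bound m hm Phi hPhi n (Yocc m d) (Hsol m n d)) with (B := 4)|].
- intros l Hl'. unfold Hsol. rewrite (poisson_equation m hm n d hd hn l Hl').
  unfold Yocc at 2. rewrite (Ex_lin m hm). unfold Yocc. do 2 f_equal.
  rewrite <- (Rmult_1_r (pb m n d)). symmetry. apply (EB_single m hm n d (fun _ => 1)).
- lra.
- intros l l'. apply (Hsol_bound m hm n d hd hn).
- exact Hv.
- unfold r_nm, sigma_nm. rewrite <- (Var_Yocc_sigma2 m hm d n hn).
  set (V := Var m n (Yocc m d)) in *. set (L := INR n / INR m) in *.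
  assert (Hs : 0 < sqrt V) by (apply sqrt_lt_R0; exact Hv).
  assert (HV2 : sqrt V ^ 2 = V) by (apply pow2_sqrt; lra).
  assert (Hsc : INR m * pb m n d * (1 + L) ^ 4 <= 6 * V * (1 + L) ^ 4).
  { apply Rmult_le_compat_r; [apply pow_le; lra|lra]. }
  assert (Hloc : 0 <= Kloc d).
  { unfold Kloc. assert (0 <= (INR d + 2) * INR d ^ 2) by (apply Rmult_le_pos; [lra|apply pow2_ge_0]). lra. }
  assert (Hloc2 : 0 <= Kloc d * (10 * INR d + 12) ^ 2) by (apply Rmult_le_pos; [exact Hloc|apply pow2_ge_0]).
  assert (Htot : 0 <= Ktot d).
  { unfold Ktot. assert (0 <= (INR d + 2) * INR d ^ 2) by (apply Rmult_le_pos; [lra|apply pow2_ge_0]).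
    assert (0 <= INR d ^ 4) by (apply pow_le; lra). generalize (pow2_ge_0 (INR d + 2)). lra. }
  assert (Hroot : forall K X, 0 <= K -> X <= K * (INR m * pb m n d * (1 + L) ^ 4) ->
     sqrt X <= sqrt (6 * K) * (sqrt V * (1 + L) ^ 2)).
  { intros K X HK HX. apply sqrt_le_of_sq.
    - apply Rmult_le_pos; [apply sqrt_pos|]. apply Rmult_le_pos; [lra|apply pow2_ge_0].
    - replace ((sqrt (6 * K) * (sqrt V * (1 + L) ^ 2)) ^ 2)
        with (sqrt (6 * K) ^ 2 * (sqrt V ^ 2 * (1 + L) ^ 4)) by ring.
      rewrite HV2, pow2_sqrt by lra.
      eapply Rle_trans; [exact HX|].
      replace (6 * K * (V * (1 + L) ^ 4)) with (K * (6 * V * (1 + L) ^ 4)) by ring.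
      apply Rmult_le_compat_l; assumption. }
  generalize (Hroot _ _ Htot (Var_swapYY m hm n d hd hn)),
    (Hroot _ _ Hloc2 (Var_swapY m hm n d hd hn)). fold K1 K2. intros R1 R2.
  assert (H1 : 0 <= K1) by apply sqrt_pos. assert (H2 : 0 <= K2) by apply sqrt_pos.
  assert (HL : (1 + L) ^ 2 <= 4 * (1 + L ^ 3)).
  { destruct (Rle_lt_dec L 1).
    - assert (0 <= L ^ 3) by (apply pow_le; lra). nra.
    - assert (L ^ 2 <= L ^ 3) by (simpl; nra). nra. }
  assert (H3 : 0 < 1 + L ^ 3) by (generalize (pow_lt L 3 Hl); lra).
  apply (Rle_trans _ (/ V * ((K1 + 8 * K2) * (sqrt V * (1 + L) ^ 2)))).
  + apply Rmult_le_compat_l; [left; apply Rinv_0_lt_compat; exact Hv|]. lra.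
  + replace (/ V * ((K1 + 8 * K2) * (sqrt V * (1 + L) ^ 2)))
      with ((K1 + 8 * K2) * / sqrt V * (1 + L) ^ 2) by (rewrite <- HV2 at 2; field; lra).
    replace (4 * (K1 + 8 * K2) / (sqrt V / (1 + L ^ 3)))
      with ((K1 + 8 * K2) * / sqrt V * (4 * (1 + L ^ 3))) by (field; lra).
    apply Rmult_le_compat_l; [|exact HL].
    apply Rmult_le_pos; [lra|left; apply Rinv_0_lt_compat; exact Hs].
Qed.
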